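(* Let $b$ be a positive integer. Every nonnegative integer can be written as $x^2+by^2+(z^2+zw+w^2)$ with $x,y,z,w\in\mathbb{Z}$ if and only if $b\in\{1,2,3,4,5,6\}$. *)

(* Defs.v *)
From Stdlib Require Import ZArith.
Open Scope Z_scope.

Definition represents (b n : Z) : Prop :=
  exists x y z w : Z, n = x^2 + b*y^2 + (z^2 + z*w + w^2).

(* Main.v *)
(** The ternary form [f = x^2 + z^2 + zw + w^2] has class number one: every positive ternary form
    with integral coefficients and the same discriminant reduces to it.  To represent [n] it is
    therefore enough to build such a form with first coefficient [n], and this is possible as soon
    as there is a positive [q], in a suitable residue class modulo [12 n], such that [-3 n] is a
    square modulo [q].  Instead of a prime [q] supplied by Dirichlet's theorem, we take the
    squarefree part of an integer with nonzero divisor sum [sum_(d | q) chi d], where [chi] is the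
    quadratic character attached to [-3 n]: comparing weights [x^q] over two residue classes on
    which [chi = 1], the difference of the two total weights stays bounded as [x] tends to [1],
    while the squares make the total over the class of [1] unbounded.  Reciprocity gives the
    periodicity of [chi].  This shows that [f] represents every [n] prime to [3] and every [3 m]
    with [m = 1 mod 3], and for [b <= 6] some [n - b y^2] is, up to a power of [9], of this shape.
    For [b >= 7] the number [6] is missed. *)
Require Import Defs.
From Stdlib Require Import ZArith Lia.
From mathcomp Require Import all_boot all_order all_algebra all_solvable all_field.
From mathcomp Require Import zify ring lra.

Set Implicit Arguments.
Unset Strict Implicit.
Unset Printing Implicit Defensive.

Import Order.TTheory GRing.Theory Num.Theory.
Local Open Scope ring_scope.

(** * Inequalities for powers of a base close to 1 *)

Lemma bernoulli_ge (R : realFieldType) (y : R) (n : nat) :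
  -1 <= y -> 1 + n%:R * y <= (1 + y) ^+ n.
Proof.
move=> hy; elim: n => [|n IH]; first by rewrite mul0r addr0 expr0.
have : (1 + y) * (1 + n%:R * y) <= (1 + y) * (1 + y) ^+ n.
  by apply: ler_wpM2l => //; lra.
rewrite exprS -natr1; apply: le_trans.
have : 0 <= n%:R * (y * y) by rewrite mulr_ge0 ?ler0n // -expr2 sqr_ge0.
by lra.
Qed.

(** With [y = 1/(2E)] and [x = 1 - y], Bernoulli gives [x^E >= 1/2], while [x (1 + y) <= 1] bounds
    [x^(3j)] by [(j y)^(-3)], which beats the quadratic factor [(3j)^2] once [j] is large. *)
Lemma exists_base (R : realFieldType) (E M : nat) : (0 < E)%N -> (0 < M)%N ->
  exists (x : R) (J : nat), [/\ 0 < x < 1, 1 <= 2 * x ^+ E, (E < J * M)%N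
    & 2 * (J * M)%:R ^+ 2 * x ^+ (J * M) <= 1].
Proof.
move=> E0 M0; have E0' : (0 < E%:R :> R) by rewrite ltr0n.
have E1 : (1 <= E%:R :> R) by rewrite ler1n.
pose y : R := (2 * E%:R)^-1; have y0 : 0 < y by rewrite invr_gt0 mulr_gt0.
have yE : E%:R * y = 2^-1 by rewrite /y; field; rewrite gt_eqF.
have y1 : y <= 2^-1 by rewrite -yE ler_peMl // ltW.
(* As [E y = 1/2], the factor 144 gives [(j y)^3 = 18 M j^2], at least [2 (3j)^2]. *)
pose j := (144 * E ^ 3 * M)%N; exists (1 - y), (3 * (144 * E ^ 3))%N.
have jE : (3 * (144 * E ^ 3) * M = 3 * j)%N by rewrite /j; ring.
have E3 : (0 < E ^ 3)%N by rewrite expn_gt0 E0.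
have j0 : (0 < j)%N by rewrite /j; nia.
split; first by lra.
- by have := @bernoulli_ge R (- y) E; lra.
- have : (E <= E ^ 3)%N by rewrite -{1}[E]expn1 leq_pexp2l.
  by nia.
rewrite jE; set x := 1 - y.
have xy : (x * (1 + y)) ^+ (3 * j) <= 1.
  rewrite exprn_ile1 // /x; last by have := sqr_ge0 y; lra.
  by rewrite mulr_ge0; lra.
have jy0 : 0 < j%:R * y by rewrite mulr_gt0 ?ltr0n.
have b3 : (j%:R * y) ^+ 3 <= (1 + y) ^+ (3 * j).
  rewrite mulnC exprM lerXn2r ?nnegrE ?exprn_ge0 //; try lra.
  by have := @bernoulli_ge R y j; lra.
have x0 : 0 <= x ^+ (3 * j) by rewrite exprn_ge0 // /x; lra.
have : x ^+ (3 * j) * (j%:R * y) ^+ 3 <= 1.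
  by apply: le_trans xy; rewrite [X in _ <= X]exprMn ler_wpM2l.
apply: le_trans.
rewrite [X in X <= _]mulrC ler_wpM2l // natrM.
have jR : j%:R = 144 * E%:R ^+ 3 * M%:R :> R by rewrite /j (natrM _ _ M) (natrM _ 144) natrX.
have -> : (j%:R * y) ^+ 3 = j%:R ^+ 2 * (144 * M%:R * (E%:R * y) ^+ 3).
  by rewrite {1}exprMn [j%:R ^+ 3]exprSr {2}jR; ring.
have M1 : (1 <= M%:R :> R) by rewrite ler1n.
rewrite (_ : 2 * _ = j%:R ^+ 2 * 18); last by ring.
by rewrite ler_wpM2l ?sqr_ge0 // yE; lra.
Qed.

(** This says that [(1 - z^v) / (1 - z^(v+k))] decreases in [z]. After cancelling
    [(1 - s^v) (1 - t^v)] and expanding geometric sums, it reduces to [s^i t^(v+j) <= t^i s^(v+j)]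
    for [i < v]. *)
Lemma one_sub_pow_cross (R : realFieldType) (s t : R) (v k : nat) :
  0 <= t <= s -> s <= 1 ->
  (1 - s ^+ v) * (1 - t ^+ (v + k)) <= (1 - t ^+ v) * (1 - s ^+ (v + k)).
Proof.
move=> /andP[t0 ts] s1; have t1 := le_trans ts s1.
have geo (z : R) n : 1 - z ^+ n = (1 - z) * \sum_(i < n) z ^+ i.
  by rewrite -opprB subrX1 -mulNr opprB.
suff : (1 - s ^+ v) * (t ^+ v * (1 - t ^+ k)) <= (1 - t ^+ v) * (s ^+ v * (1 - s ^+ k)).
  by rewrite !exprD; lra.
rewrite !geo.
have -> (z w : R) (a b c : R) : (1 - z) * a * (c * ((1 - w) * b)) =
  ((1 - z) * (1 - w)) * (a * (c * b)) by ring.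
have -> (z w : R) (a b c : R) : (1 - z) * a * (c * ((1 - w) * b)) =
  ((1 - w) * (1 - z)) * (a * (c * b)) by ring.
apply: ler_wpM2l; first by rewrite mulr_ge0 ?subr_ge0.
rewrite !mulr_suml; apply: ler_sum => i _; rewrite !mulr_sumr; apply: ler_sum => j _.
have iv : (i <= v + j)%N by rewrite ltnW // ltn_addr.
rewrite -!exprD -(subnK iv) !exprD !mulrA [X in X <= _]mulrC mulrA.
rewrite [X in _ <= X]mulrC mulrA [t ^+ i * s ^+ i]mulrC -!mulrA.
have s0 := le_trans t0 ts.
by rewrite ler_wpM2l ?exprn_ge0 // ler_wpM2l ?exprn_ge0 // lerXn2r.
Qed.

(** * Weights monotone in the divisor *)

Section Weight.
Variables (R : realFieldType) (x : R) (M J v : nat).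
Hypotheses (x01 : 0 < x < 1) (M0 : (0 < M)%N) (vM : (v < M)%N).
Local Notation N := (J * M)%N.

(** The sum of [x^(de)] over the multiples [e] of [M] below [N], minus the sum over their shifts by
    [v]; for [d > 0] it equals [(1 - x^(dv)) (1 - x^(dN)) / (1 - x^(dM))]. *)
Definition weight (d : nat) : R := (1 - x ^+ (d * v)) * \sum_(0 <= j < J) x ^+ (d * (j * M)).

Let x_ge0 : 0 <= x. Proof. by case/andP: x01 => /ltW. Qed.
Let x_le1 : x <= 1. Proof. by case/andP: x01 => _ /ltW. Qed.
Let pow_ge0 n : 0 <= x ^+ n. Proof. exact: exprn_ge0. Qed.
Let pow_le1 n : x ^+ n <= 1. Proof. exact: exprn_ile1. Qed.

Lemma geom_telescope (d : nat) :
  (1 - x ^+ (d * M)) * \sum_(0 <= j < J) x ^+ (d * (j * M)) = 1 - x ^+ (d * N).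
Proof.
rewrite big_mkord (eq_bigr (fun j : 'I_J => (x ^+ (d * M)) ^+ j)) => [|j _]; last first.
  by rewrite -exprM; congr (x ^+ _); ring.
rewrite -opprB mulNr -subrX1 opprB -exprM; congr (_ - x ^+ _); ring.
Qed.

Let sum_ge0 d : 0 <= \sum_(0 <= j < J) x ^+ (d * (j * M)).
Proof. by rewrite big_mkord sumr_ge0. Qed.

Lemma weight_ge0 d : 0 <= weight d.
Proof. by rewrite mulr_ge0 ?subr_ge0. Qed.

Lemma weight_le1 d : weight d <= 1.
Proof.
apply: (@le_trans _ _ (1 - x ^+ (d * N))); last by rewrite lerBlDr lerDl.
rewrite -geom_telescope ler_wpM2r // lerD2l lerN2 ler_wiXn2l ?x_ge0 //.
by rewrite leq_mul2l (ltnW vM) orbT.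
Qed.

(** In the closed form, [1 - x^(dN)] grows with [d], and so does [(1 - x^(dv)) / (1 - x^(dM))], by
    [one_sub_pow_cross] for [x^e <= x^d]. *)
Lemma weight_homo d e : (d <= e)%N -> weight d <= weight e.
Proof.
case: d => [|d] de; first by rewrite /weight mul0n expr0 subrr mul0r weight_ge0.
have lt1 n : (0 < n)%N -> x ^+ (n * M) < 1.
  by case/andP: x01 => _ x1 n0; rewrite exprn_ilt1 // -lt0n muln_gt0 n0.
have := @one_sub_pow_cross R (x ^+ d.+1) (x ^+ e) v (M - v).
rewrite pow_ge0 ler_wiXn2l // pow_le1 => /(_ isT isT).
rewrite subnKC ?(ltnW vM) // -!exprM => cross.
have d1 : 0 < 1 - x ^+ (d.+1 * M) by rewrite subr_gt0 lt1.
have e1 : 0 < 1 - x ^+ (e * M) by rewrite subr_gt0 lt1 //; lia.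
rewrite -(ler_pM2l d1) -(ler_pM2l e1) /weight.
set A := 1 - x ^+ (d.+1 * v) in cross *; set B := 1 - x ^+ (e * v) in cross *.
set a := 1 - x ^+ (d.+1 * M) in d1 cross *; set b := 1 - x ^+ (e * M) in e1 cross *.
have dN := geom_telescope d.+1; have eN := geom_telescope e.
rewrite -/a in dN; rewrite -/b in eN.
set Sd := \sum_(_ <= _ < _) _ in dN *; set Se := \sum_(_ <= _ < _) _ in eN *.
have -> : b * (a * (A * Sd)) = (A * b) * (a * Sd) by ring.
have -> : b * (a * (B * Se)) = (B * a) * (b * Se) by ring.
rewrite dN eN; apply: ler_pM => //.
- by rewrite mulr_ge0 ?(ltW e1) // subr_ge0.
- by rewrite subr_ge0.
by rewrite lerD2l lerN2 ler_wiXn2l // leq_mul2r de orbT.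
Qed.
End Weight.

(** For [u <= w < M] the progressions interlace, [u + jM <= w + jM <= u + (j+1)M], so the difference
    is at most the telescoping sum [h (u + JM) - h u]. *)
Lemma interleaved_sums (R : realFieldType) (h : nat -> R) (M J u w : nat) :
  {homo h : i j / (i <= j)%N >-> i <= j} -> (forall i, 0 <= h i <= 1) ->
  (u < M)%N -> (w < M)%N ->
  `|\sum_(0 <= j < J) h (u + j * M)%N - \sum_(0 <= j < J) h (w + j * M)%N| <= 1.
Proof.
move=> hh h01; wlog uw : u w / (u <= w)%N.
  by move=> H uM wM; case: (leqP u w) => [|/ltnW] uw; [|rewrite distrC]; apply: H.
move=> uM wM; rewrite distrC ger0_norm ?subr_ge0; last first.
  by apply: ler_sum => j _; apply: hh; rewrite leq_add2r.
have : \sum_(0 <= j < J) h (w + j * M)%N <= \sum_(0 <= j < J) h (u + j.+1 * M)%N.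
  by apply: ler_sum => j _; apply: hh; rewrite mulSn; lia.
have : \sum_(0 <= j < J) h (u + j.+1 * M)%N - \sum_(0 <= j < J) h (u + j * M)%N
   = h (u + J * M)%N - h (u + 0 * M)%N.
  by rewrite -sumrB (telescope_sumr (fun j => h (u + j * M)%N)).
have /andP[_ h1] := h01 (u + J * M)%N; have /andP[h0 _] := h01 (u + 0 * M)%N.
by lra.
Qed.

Lemma sum_blocks (R : nmodType) (F : nat -> R) (M J : nat) :
  \sum_(0 <= e < J * M) F e = \sum_(0 <= v < M) \sum_(0 <= j < J) F (v + j * M)%N.
Proof.
rewrite big_nat_mul exchange_big_nat /=; apply: eq_bigr => j _.
by rewrite -{1}[(j * M)%N]add0n big_addn mulSn addnK.
Qed.

Lemma modn_solve (M a d : nat) : (0 < M)%N -> coprime d M ->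
  exists2 u, (u < M)%N & forall v, (d * v == a %[mod M])%N = (v == u %[mod M])%N.
Proof.
move=> M0 dM; pose w := (d ^ (totient M).-1)%N.
have wd : (w * d)%N = 1 %[mod M].
  by rewrite -expnSr prednK ?totient_gt0 // Euler_exp_totient.
exists (w * a %% M)%N; first by rewrite ltn_pmod.
move=> v; rewrite modn_mod; apply/eqP/eqP => e.
  by rewrite -modnMmr -e modnMmr mulnA -modnMml wd modnMml mul1n.
by rewrite -modnMmr e modnMmr mulnA [(d * w)%N]mulnC -modnMml wd modnMml mul1n.
Qed.

Lemma count_residue (R : pzSemiRingType) (M u : nat) : (u < M)%N ->
  \sum_(0 <= v < M) (v == u %[mod M])%:R = 1 :> R.
Proof.
move=> uM; rewrite (bigD1_seq u) ?mem_index_iota ?iota_uniq //= eqxx.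
rewrite big_seq_cond big1 ?addr0 // => v; rewrite mem_index_iota => /andP[vM vu].
by rewrite !modn_small // (negbTE vu).
Qed.

Lemma sum_alternating n : \sum_(i < n) (-1) ^+ i = (odd n)%:Z :> int.
Proof.
elim: n => [|n IH]; first by rewrite big_ord0.
by rewrite big_ord_recr /= IH -signr_odd; case: (odd n).
Qed.

(** * Divisor sums of completely multiplicative functions with values in {-1, 0, 1} *)

Definition divisor_sum (f : nat -> int) (n : nat) : int := \sum_(d <- divisors n) f d.

Section DivisorSum.
Variable f : nat -> int.
Hypotheses (f1 : f 1%N = 1) (fM : {morph f : i j / (i * j)%N >-> i * j}).
Hypothesis f_le1 : forall n, `|f n| <= 1.

Let fX p i : f (p ^ i)%N = f p ^+ i.
Proof. by elim: i => [|i IH]; rewrite ?expn0 ?f1 ?expr0 // expnS exprS fM IH. Qed.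

Lemma divisor_sum_pM (p k m : nat) : prime p -> coprime p m -> (0 < m)%N ->
  divisor_sum f (p ^ k * m) = (\sum_(i < k.+1) f p ^+ i) * divisor_sum f m.
Proof.
move=> pp pm m0; have p0 := prime_gt0 pp.
have pkm0 : (0 < p ^ k * m)%N by rewrite muln_gt0 expn_gt0 p0.
have perm : perm_eq (divisors (p ^ k * m)) [seq (p ^ i * d)%N | i <- iota 0 k.+1, d <- divisors m].
  apply: uniq_perm; first exact: divisors_uniq.
    apply: allpairs_uniq; rewrite ?iota_uniq ?divisors_uniq //.
    move=> [i d] [j e] /allpairsP[[i' d'] [_ dm [-> ->]]] /allpairsP[[j' e'] [_ em [-> ->]]] eq.
    move: dm em eq; rewrite -!dvdn_divisors //= => dm em eq.
    have lg a b : (b %| m)%N -> logn p (p ^ a * b) = a.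
      move=> bm; rewrite mulnC logn_Gauss ?pfactorK //; exact: coprime_dvdr pm.
    have ij : i' = j' by rewrite -(lg i' d' dm) eq lg.
    by move: eq; rewrite ij => /eqP; rewrite eqn_pmul2l ?expn_gt0 ?p0 // => /eqP ->.
  move=> d; rewrite -dvdn_divisors //; apply/idP/allpairsP => [dd|[[i e] [hi he ->]]].
    have d0 := dvdn_gt0 pkm0 dd; have [e pe de] := pfactor_coprime pp d0.
    exists (logn p d, e); split; last by rewrite mulnC.
      rewrite mem_iota /= add0n ltnS; have := dvdn_leq_log p pkm0 dd.
      by rewrite (mulnC (p ^ k)%N) logn_Gauss // pfactorK.
    rewrite -dvdn_divisors // -(@Gauss_dvdr e (p ^ k) m) ?coprimeXr 1?coprime_sym //.
    by apply: dvdn_trans dd; rewrite de dvdn_mulr.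
  rewrite dvdn_mul //; last by rewrite dvdn_divisors.
  by rewrite dvdn_exp2l //; move: hi; rewrite mem_iota /= add0n ltnS.
rewrite /divisor_sum (perm_big _ perm) big_allpairs_dep.
rewrite (_ : iota 0 k.+1 = index_iota 0 k.+1) ?subn0 // big_mkord mulr_suml.
by apply: eq_bigr => i _; rewrite mulr_sumr; apply: eq_bigr => d _; rewrite fM fX.
Qed.

Let val_f p : [\/ f p = 1, f p = 0 | f p = -1].
Proof.
have : [|| f p == 1, f p == 0 | f p == -1] by have := f_le1 p; lia.
by case/or3P => /eqP ->; [constructor 1 | constructor 2 | constructor 3].
Qed.

(** The local factor at [p] is [k + 1] if [f p = 1], and 1 if [f p = 0]; if [f p = -1] it is 1 or 0
    according as [k] is even or odd. It thus vanishes only for [f p = -1] and [k] odd. *)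
Let geom_f_ge0 p k : 0 <= \sum_(i < k.+1) f p ^+ i :> int.
Proof.
case: (val_f p) => ->; first by rewrite sumr_ge0 // => i _; rewrite exprn_ge0.
  by rewrite sumr_ge0 // => i _; rewrite exprn_ge0.
by rewrite sum_alternating.
Qed.

Let geom_f_even p k : ~~ odd k -> 1 <= \sum_(i < k.+1) f p ^+ i :> int.
Proof.
case: (val_f p) => ->.
- by rewrite big_ord_recl /= expr0 lerDl sumr_ge0 // => i _; rewrite exprn_ge0.
- by rewrite big_ord_recl /= expr0 lerDl sumr_ge0 // => i _; rewrite exprn_ge0.
by rewrite sum_alternating /= => ->.
Qed.

Let divisor_sum1 : divisor_sum f 1 = 1.
Proof. by rewrite /divisor_sum /divisors big_seq1. Qed.

Lemma divisor_sum_ge0 n : (0 < n)%N -> 0 <= divisor_sum f n.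
Proof.
elim/ltn_ind: n => n IH n0; case: (ltnP 1 n) => n1; last first.
  by rewrite (_ : n = 1%N) ?divisor_sum1 //; lia.
have pp := pdiv_prime n1; have [m pm nE] := pfactor_coprime pp n0.
have lg : (0 < logn (pdiv n) n)%N by rewrite logn_gt0 mem_primes pp n0 pdiv_dvd.
have m0 : (0 < m)%N by move: n0; rewrite nE muln_gt0 => /andP[].
rewrite nE mulnC divisor_sum_pM // mulr_ge0 // IH //.
by rewrite [ltnRHS]nE ltn_Pmulr // -{1}(expn0 (pdiv n)) ltn_exp2l ?prime_gt1.
Qed.

Lemma divisor_sum_square n : (0 < n)%N -> (forall p, ~~ odd (logn p n)) ->
  1 <= divisor_sum f n.
Proof.
elim/ltn_ind: n => n IH n0 ev; case: (ltnP 1 n) => n1; last first.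
  by rewrite (_ : n = 1%N) ?divisor_sum1 //; lia.
have pp := pdiv_prime n1; have [m pm nE] := pfactor_coprime pp n0.
have lg : (0 < logn (pdiv n) n)%N by rewrite logn_gt0 mem_primes pp n0 pdiv_dvd.
have m0 : (0 < m)%N by move: n0; rewrite nE muln_gt0 => /andP[].
rewrite nE mulnC divisor_sum_pM // mulr_ege1 ?geom_f_even // IH //.
  by rewrite [ltnRHS]nE ltn_Pmulr // -{1}(expn0 (pdiv n)) ltn_exp2l ?prime_gt1.
move=> q; have := ev q; rewrite {1}nE lognM // ?expn_gt0 ?prime_gt0 // lognX oddD oddM.
by rewrite (negbTE (ev _)) addbF.
Qed.

Lemma divisor_sum_neq0 n p : (0 < n)%N -> prime p -> divisor_sum f n != 0 ->
  odd (logn p n) -> f p != -1.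
Proof.
move=> n0 pp; have [m pm nE] := pfactor_coprime pp n0.
have m0 : (0 < m)%N by move: n0; rewrite nE muln_gt0 => /andP[].
rewrite {1}nE mulnC divisor_sum_pM // mulf_eq0 negb_or => /andP[g0 _] o.
apply: contraNneq g0 => ->.
by rewrite sum_alternating /= o.
Qed.
End DivisorSum.

(** * Comparison of the divisor sums over two residue classes *)

Section Box.
Variables (f : nat -> int) (M J a : nat) (x : rat).
Hypotheses (f1 : f 1%N = 1) (fM : {morph f : i j / (i * j)%N >-> i * j}).
Hypothesis f_le1 : forall n, `|f n| <= 1.
Hypothesis f_mod : forall i j, i = j %[mod M] -> f i = f j.
Hypotheses (M1 : (1 < M)%N) (aM : coprime a M) (fa : f a = 1) (x01 : 0 < x < 1).
Local Notation N := (J * M)%N.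
Let M0 : (0 < M)%N := ltnW M1.

(** A truncation to [d, e < N] of the Lambert series of [divisor_sum f] on the class of [c]. A
    square, rather than [d e < N], lets [e] run through complete progressions modulo [M]. *)
Definition box (c : nat) : rat :=
  \sum_(0 <= d < N) \sum_(0 <= e < N) (d * e == c %[mod M])%:R * ((f d)%:~R * x ^+ (d * e)).

Let H (v d : nat) : rat := weight x M J v d.
Let C (d : nat) : rat := \sum_(0 <= j < J) x ^+ (d * (j * M)).

Let boxE c : box c = \sum_(0 <= d < N) \sum_(0 <= v < M)
  (d * v == c %[mod M])%:R * ((f d)%:~R * (C d - H v d)).
Proof.
apply: eq_bigr => d _; rewrite sum_blocks; apply: eq_bigr => v _.
rewrite (eq_bigr (fun j =>
  (d * v == c %[mod M])%:R * ((f d)%:~R * (x ^+ (d * v) * x ^+ (d * (j * M)))))).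
  by rewrite -!mulr_sumr /H /weight -/(C d); ring.
move=> j _; rewrite -exprD -mulnDr; congr ((_ : bool)%:R * _).
by rewrite mulnDr mulnA -modnDmr modnMl addn0.
Qed.

Let count_ind c d : coprime c M ->
  \sum_(0 <= v < M) (d * v == c %[mod M])%:R = (coprime d M)%:R :> rat.
Proof.
move=> cM; case: (boolP (coprime d M)) => dM.
  have [u uM hu] := modn_solve c M0 dM.
  by rewrite (eq_bigr _ (fun v _ => congr1 (fun b : bool => b%:R) (hu v))) count_residue.
rewrite big1 // => v _; case: eqP => // e; case/negP: dM.
by move: cM; rewrite -coprime_modl -e coprime_modl coprimeMl => /andP[].
Qed.

(** Here [f d * f v = f c = 1] forces [f d = f v]: the sign then depends on [v] only, leaving sums
    over [d] of monotone weights. *)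
Let f_ind c d v : coprime c M -> f c = 1 ->
  (d * v == c %[mod M])%:R * (f d)%:~R = (d * v == c %[mod M])%:R * (f v)%:~R :> rat.
Proof.
move=> cM fc; case: eqP => [/f_mod|]; last by rewrite !mul0r.
rewrite fM fc => e; congr (_ * _%:~R); have := f_le1 d; have := f_le1 v.
by case: (f d) (f v) e => [[|[|?]]|[|?]] [[|[|?]]|[|?]]; lia.
Qed.

(** The terms in [C d] have the same total for both classes and cancel. For each [v < M] there
    remains, up to the factor [f v], a difference of sums of [H v] over two progressions of [d], at
    most 1 by interlacing. *)
Lemma box_diff : box 1 - box a <= M%:R.
Proof.
pose S c v : rat := \sum_(0 <= d < N) (d * v == c %[mod M])%:R * H v d.
have boxS c : coprime c M -> f c = 1 -> box c =
    \sum_(0 <= d < N) (coprime d M)%:R * ((f d)%:~R * C d)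
    - \sum_(0 <= v < M) (f v)%:~R * S c v.
  move=> cM fc; rewrite boxE.
  rewrite (eq_bigr (fun d => (coprime d M)%:R * ((f d)%:~R * C d) -
     \sum_(0 <= v < M) (f v)%:~R * ((d * v == c %[mod M])%:R * H v d))); last first.
    move=> d _; rewrite -(count_ind d cM) mulr_suml -sumrB; apply: eq_bigr => v _.
    by rewrite mulrBr mulrBr; congr (_ - _); rewrite mulrA f_ind //; ring.
  rewrite sumrB; congr (_ - _); rewrite exchange_big_nat /=.
  by apply: eq_bigr => v _; rewrite mulr_sumr.
rewrite !boxS ?coprime1n // opprD addrACA subrr add0r opprK addrC -sumrB.
apply: (le_trans (ler_norm _)); apply: (le_trans (ler_norm_sum _ _ _)).
rewrite -[M in X in _ <= X]subn0 -[(M - 0)%N%:R]/(1 *+ (M - 0)) -sumr_const_nat.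
apply: ler_sum_nat => v /andP[_ vM]; rewrite -mulrBr normrM.
apply: mulr_ile1 => //; first by rewrite -intr_norm -[1]/(1%:~R) ler_int f_le1.
case: (boolP (coprime v M)) => cv; last first.
  have S0 c : coprime c M -> S c v = 0.
    move=> cM; rewrite /S big1 // => d _; case: eqP => [e|]; rewrite ?mul0r //.
    case/negP: cv; move: cM; rewrite -coprime_modl -e coprime_modl coprimeMl.
    by case/andP.
  by rewrite !S0 ?coprime1n // subrr normr0.
have SE c : exists2 u, (u < M)%N & S c v = \sum_(0 <= j < J) H v (u + j * M)%N.
  have [u uM hu] := modn_solve c M0 cv; exists u => //.
  rewrite /S sum_blocks (bigD1_seq u) ?mem_index_iota ?iota_uniq //=.
  rewrite [X in _ + X]big_seq_cond [X in _ + X]big1 ?addr0 => [|w].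
    by apply: eq_bigr => j _; rewrite mulnC hu -modnDmr modnMl addn0 eqxx mul1r.
  rewrite mem_index_iota => /andP[wM wu]; apply: big1 => j _.
  by rewrite mulnC hu -modnDmr modnMl addn0 !modn_small // (negbTE wu) mul0r.
have [u uM ->] := SE a; have [w wM ->] := SE 1%N.
apply: interleaved_sums => // [i j ij|i]; first exact: weight_homo.
by rewrite weight_ge0 //= weight_le1.
Qed.
End Box.

Lemma sum_nat_pred1 (R : pzSemiRingType) (n k : nat) (F : nat -> R) :
  \sum_(0 <= i < n) (k == i)%:R * F i = (k < n)%:R * F k.
Proof.
case: ltnP => kn.
  rewrite (bigD1_seq k) ?mem_index_iota ?iota_uniq //= eqxx.
  by rewrite big1 ?addr0 // => i; rewrite eq_sym => /negbTE ->; rewrite mul0r.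
rewrite mul0r big_nat_cond big1 // => i /andP[/andP[_ ik] _].
by rewrite (_ : (k == i) = false) ?mul0r //; lia.
Qed.

Lemma divisor_sum_pairs (f : nat -> int) (n q : nat) : (0 < q < n)%N ->
  \sum_(0 <= d < n) \sum_(0 <= e < n) (d * e == q)%:R * (f d)%:~R
   = (divisor_sum f q)%:~R :> rat.
Proof.
move=> /andP[q0 qn].
transitivity (\sum_(0 <= d < n | (d %| q)%N) ((f d)%:~R : rat)).
  rewrite [RHS]big_mkcond; apply: eq_bigr => d _; case: ifP => dq.
    have d0 := dvdn_gt0 q0 dq; have e := divnK dq.
    rewrite (eq_bigr (fun i => ((q %/ d)%N == i)%:R * (f d)%:~R)).
      rewrite (sum_nat_pred1 _ _ (fun=> _)) (_ : (_ < n)%N) ?mul1r //.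
      by apply: leq_ltn_trans qn; exact: leq_div.
    by move=> i _; rewrite -[in LHS]e mulnC eqn_pmul2l // eq_sym.
  by rewrite big1 // => i _; case: eqP dq => [<-|]; rewrite ?dvdn_mulr ?mul0r.
rewrite /divisor_sum rmorph_sum -big_filter; apply: perm_big; apply: uniq_perm.
- by rewrite filter_uniq // iota_uniq.
- exact: divisors_uniq.
move=> d; rewrite mem_filter mem_index_iota -dvdn_divisors //=.
by case: (boolP (d %| q)%N) => //= /(dvdn_leq q0); lia.
Qed.

Section BoxSplit.
Variables (f : nat -> int) (M J : nat) (x : rat).
Hypotheses (f_le1 : forall n, `|f n| <= 1) (M1 : (1 < M)%N) (x01 : 0 < x < 1).
Local Notation N := (J * M)%N.

(** The subtracted sum is the part of the box with [d e < N]; each of the at most [N^2] other pairs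
    contributes at most [x^N]. *)
Lemma box_split c : coprime c M ->
  `|box f M J x c - \sum_(0 <= q < N) (q == c %[mod M])%:R * ((divisor_sum f q)%:~R * x ^+ q)|
    <= N%:R ^+ 2 * x ^+ N.
Proof.
move=> cM; have [x0 x1] := andP x01.
have -> : \sum_(0 <= q < N) (q == c %[mod M])%:R * ((divisor_sum f q)%:~R * x ^+ q) =
  \sum_(0 <= d < N) \sum_(0 <= e < N) (d * e < N)%N%:R *
     ((d * e == c %[mod M])%:R * ((f d)%:~R * x ^+ (d * e))).
  under [RHS]eq_bigr => d _ do under eq_bigr => e _ do
    rewrite -(sum_nat_pred1 _ _ (fun q => (q == c %[mod M])%:R * ((f d)%:~R * x ^+ q))).
  under [RHS]eq_bigr => d _ do rewrite exchange_big_nat.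
  rewrite [RHS]exchange_big_nat; apply: eq_big_nat => q /andP[_ qN].
  (* Zero has no finite list of divisors to compare with, but it is not in the class of [c], which
     is coprime to [M > 1]. *)
  case: (posnP q) => [->|q0].
    rewrite mod0n eq_sym -/(dvdn M c) (_ : (M %| c)%N = false); last first.
      by apply/negP => Mc; have := coprime_dvdl Mc cM; rewrite /coprime gcdnn; lia.
    by rewrite mul0r big1 // => d _; rewrite big1 // => e _; rewrite mul0r mulr0.
  rewrite -(@divisor_sum_pairs f N) ?q0 // mulr_suml mulr_sumr.
  apply: eq_bigr => d _; rewrite mulr_suml mulr_sumr; apply: eq_bigr => e _.
  by ring.
rewrite /box -sumrB; apply: (le_trans (ler_norm_sum _ _ _)).
have -> : N%:R ^+ 2 * x ^+ N = \sum_(0 <= d < N) \sum_(0 <= e < N) x ^+ N.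
  by rewrite !sumr_const_nat !subn0 -(mulr_natl (_ *+ _)) -(mulr_natl (x ^+ _)) mulrA -expr2.
apply: ler_sum => d _; rewrite -sumrB; apply: (le_trans (ler_norm_sum _ _ _)).
apply: ler_sum => e _; case: ltnP => de.
  by rewrite mul1r subrr normr0 exprn_ge0 // ltW.
rewrite mul0r subr0 normrM; apply: le_trans (_ : 1 * x ^+ N <= _); last by rewrite mul1r.
apply: ler_pM => //; first by case: eqP; rewrite ?normr0 ?normr1.
rewrite normrM -[x ^+ N]mul1r; apply: ler_pM => //.
  by rewrite -intr_norm -[1]/(1%:~R) ler_int f_le1.
rewrite ger0_norm ?exprn_ge0 ?(ltW x0) //.
by rewrite ler_wiXn2l // ltW.
Qed.
End BoxSplit.

(* The sums of [divisor_sum f q * x^q] over the classes of [a] and of [1] stay at bounded distance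
   as [x] tends to [1], whereas the squares make the second one unbounded. *)
Lemma exists_divisor_sum_neq0 (f : nat -> int) (M a : nat) :
  f 1%N = 1 -> {morph f : i j / (i * j)%N >-> i * j} -> (forall n, `|f n| <= 1) ->
  (forall i j, i = j %[mod M] -> f i = f j) ->
  (1 < M)%N -> coprime a M -> f a = 1 ->
  exists q, [/\ (0 < q)%N, q = a %[mod M] & divisor_sum f q != 0].
Proof.
move=> f1 fM f_le1 f_mod M1 aM fa.
(* The [L] squares [(1 + i M)^2] are at most [E], so each has weight at least 1/2 and
   [S >= L/2 = M + 2]. Two truncation errors of at most 1/2 and [box_diff] would give
   [S <= M + 1]. *)
pose L := (2 * M + 4)%N; pose E := ((1 + L * M) ^ 2)%N.
have E0 : (0 < E)%N by rewrite expn_gt0 addn_gt0.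
have [x [J [x01 xE EN xN]]] := @exists_base rat E M E0 (ltnW M1).
set N := (J * M)%N in EN xN; have [x0 x1] := andP x01.
case: (boolP [exists q : 'I_N, [&& (0 < q)%N, (q == a %[mod M])%N & divisor_sum f q != 0]]).
  by move=> /existsP[q /and3P[q0 /eqP qa rq]]; exists q.
move=> /existsPn none; exfalso.
have diff := @box_diff f M J a x f1 fM f_le1 f_mod M1 aM fa x01.
have := @box_split f M J x f_le1 M1 x01 a aM; rewrite -/N.
rewrite [X in _ - X]big_nat_cond [X in _ - X]big1 ?subr0 => [boxa|q]; last first.
  move=> /andP[/andP[_ qN] _]; case: eqP => [qa|]; last by rewrite mul0r.
  have := none (Ordinal qN); rewrite /= qa eqxx /= negb_and -eqn0Ngt negbK.
  case/orP => /eqP e; last by rewrite e mul0r mulr0.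
  move: aM; rewrite -coprime_modl -qa e mod0n /coprime gcd0n.
  by move=> /eqP M_1; move: M1; rewrite M_1.
have := @box_split f M J x f_le1 M1 x01 1%N (coprime1n M); rewrite -/N.
set S := \sum_(_ <= _ < _) _ => box1.
suff : L%:R <= 2 * S.
  have := ler_norm (box f M J x a); have := ler_norm (box f M J x a * -1).
  have := ler_norm (S - box f M J x 1); rewrite distrC normrM normrN1 mulr1.
  by rewrite /L natrD natrM; move: boxa box1 diff xN; lra.
pose s := [seq ((1 + i * M) ^ 2)%N | i <- iota 0 L].
have s_uniq : uniq s.
  rewrite map_inj_uniq ?iota_uniq // => i j /eqP; rewrite eqn_exp2r // eqn_add2l.
  by rewrite eqn_pmul2r ?(ltnW M1) // => /eqP.
have term_ge0 q : (0 : rat) <= (q == 1 %[mod M])%:R * ((divisor_sum f q)%:~R * x ^+ q).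
  case: eqP => [q1|]; last by rewrite mul0r.
  rewrite mul1r mulr_ge0 ?exprn_ge0 ?(ltW x0) // ler0z divisor_sum_ge0 //.
  by case: q q1 => // /eqP; rewrite mod0n modn_small // .
have sN : {subset s <= index_iota 0 N}.
  move=> q /mapP[i]; rewrite mem_iota mem_index_iota /= add0n => iL ->.
  apply: leq_ltn_trans EN; rewrite leq_exp2r // leq_add2l leq_mul2r.
  by rewrite (ltnW iL) orbT.
rewrite /S (bigID (mem s)) /= -big_filter.
rewrite (perm_big s) /=; last first.
  apply: uniq_perm => //; first by rewrite filter_uniq // iota_uniq.
  by move=> q; rewrite mem_filter andb_idr //; apply: sN.
rewrite mulrDr -[L%:R]addr0; apply: lerD; last first.
  by rewrite mulr_ge0 // sumr_ge0.
rewrite big_map mulr_sumr -[L in L%:R](size_iota 0) -sum1_size natr_sum.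
rewrite big_seq [X in _ <= X]big_seq; apply: ler_sum => i; rewrite mem_iota add0n => /= iL.
have -> : ((1 + i * M) ^ 2 == 1 %[mod M])%N.
  by rewrite -modnXm addnC modnMDl modnXm exp1n.
rewrite mul1r mulrCA.
have r1 : 1 <= divisor_sum f ((1 + i * M) ^ 2)%N.
  apply: (divisor_sum_square f1 fM f_le1); first by rewrite expn_gt0.
  by move=> p; rewrite lognX oddM.
apply: (@le_trans _ _ (1 * (2 * x ^+ ((1 + i * M) ^ 2)%N))).
  rewrite mul1r; apply: (le_trans xE); rewrite ler_wpM2l // ler_wiXn2l ?(ltW x0) ?(ltW x1) //.
  by rewrite leq_exp2r // leq_add2l leq_mul2r (ltnW iL) orbT.
by rewrite ler_wpM2r ?mulr_ge0 ?exprn_ge0 ?(ltW x0) // -[1]/(1%:~R) ler_int.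
Qed.

(** * The Legendre symbol, defined by Euler's criterion *)

Definition legendre (p : nat) (k : int) : int :=
  let y := (k%:~R : 'F_p) ^+ p.-1./2 in
  if y == 1 then 1 else if y == 0 then 0 else -1.

Lemma legendre_le1 p k : `|legendre p k| <= 1.
Proof. by rewrite /legendre; do 2?case: ifP. Qed.

Section Legendre.
Variable p : nat.
Hypotheses (p_pr : prime p) (p_odd : odd p).
Local Notation h := p.-1./2.

Let p_gt2 : (2 < p)%N.
Proof. by rewrite odd_prime_gt2. Qed.

Let p_eq : p = (h.*2).+1.
Proof. by move: p_gt2 p_odd; lia. Qed.

Let h_gt0 : (0 < h)%N. Proof. by move: p_gt2 p_odd; lia. Qed.

Lemma natF_eq0 (k : nat) : ((k%:R : 'F_p) == 0) = (p %| k)%N.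
Proof. by rewrite (dvdn_pcharf (pchar_Fp p_pr)). Qed.

Lemma intF_eq0 (k : int) : ((k%:~R : 'F_p) == 0) = (p %| `|k|)%N.
Proof.
rewrite -natF_eq0; case: k => n //=.
by rewrite NegzE mulrNz oppr_eq0.
Qed.

(** Since [p > 2] separates -1, 0 and 1, identities between symbols can be checked in the field. *)
Lemma intF_inj (a b : int) : `|a| <= 1 -> `|b| <= 1 ->
  (a%:~R : 'F_p) = b%:~R -> a = b.
Proof.
move=> ha hb /eqP; rewrite -subr_eq0 -mulrzBr intF_eq0 => /dvdn_leq hab.
move: p_gt2 hab; lia.
Qed.

Lemma Fermat_half (y : 'F_p) : y != 0 -> y ^+ h = 1 \/ y ^+ h = -1.
Proof.
move=> y0; have hp : y ^+ h.*2 = 1.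
  by apply: (mulfI y0); rewrite -exprS -p_eq mulr1 -{2}(expf_card y) card_Fp.
have : (y ^+ h - 1) * (y ^+ h + 1) = 0.
  by rewrite -subr_sqr -exprM muln2 hp expr1n subrr.
by move/eqP; rewrite mulf_eq0 subr_eq0 addr_eq0 => /orP[] /eqP ->; [left|right].
Qed.

Lemma legendreE (k : int) : (legendre p k)%:~R = (k%:~R : 'F_p) ^+ h.
Proof.
rewrite /legendre; case: eqVneq => [->//|n1]; case: eqVneq => [->//|n0].
have k0 : (k%:~R : 'F_p) != 0 by apply: contraNneq n0 => ->; rewrite expr0n eqn0Ngt h_gt0.
by case: (Fermat_half k0) n1 => ->; rewrite ?eqxx.
Qed.

Lemma legendreM (j k : int) : legendre p (j * k) = legendre p j * legendre p k.
Proof.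
apply: intF_inj; rewrite ?legendre_le1 //; last first.
  by rewrite rmorphM /= !legendreE rmorphM exprMn.
by rewrite normrM mulr_ile1 ?legendre_le1.
Qed.

Lemma legendre_mod (j k : int) :
  (p %| `|j - k|)%N -> legendre p j = legendre p k.
Proof.
by rewrite -intF_eq0 mulrzBr subr_eq0 => /eqP e; rewrite /legendre e.
Qed.

Lemma legendre1 : legendre p 1 = 1.
Proof. by rewrite /legendre expr1n eqxx. Qed.

Lemma legendreN1 : legendre p (-1) = (-1) ^+ h.
Proof.
apply: intF_inj; rewrite ?legendre_le1 ?normrX ?normrN1 ?expr1n //.
by rewrite legendreE rmorphXn /= rmorphN1.
Qed.

Lemma legendre_sq (k : int) : ~~ (p %| `|k|)%N -> legendre p k * legendre p k = 1.
Proof.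
rewrite -intF_eq0 => k0; have e := legendreE k; have := legendre_le1 p k.
case: (Fermat_half k0) e => -> e hl.
  by rewrite (@intF_inj (legendre p k) 1).
by rewrite (@intF_inj (legendre p k) (-1)).
Qed.

(** Write [k] as [z^i] with [z] a primitive root: [z^(i h) = 1] forces [2h = p - 1] to divide [i h],
    so [i] is even. *)
Lemma legendre_square (k : int) : legendre p k = 1 ->
  exists x : nat, (p %| `|x%:Z ^+ 2 - k|)%N.
Proof.
move=> lk; set y : 'F_p := k%:~R; have yh : y ^+ h = 1 by rewrite -legendreE lk.
have y0 : y != 0.
  by apply: contra_eqN yh => /eqP ->; rewrite expr0n eqn0Ngt h_gt0 eq_sym oner_eq0.
have u1 (x : 'F_p) : x != 0 -> x ^+ p.-1 = 1.
  move=> x0; apply: (mulfI x0); rewrite -exprS prednK ?prime_gt0 // mulr1.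
  by rewrite -{2}(expf_card x) card_Fp.
have /hasP[z _ z_prim] : has p.-1.-primitive_root [seq x <- enum 'F_p | x != 0].
  apply: has_prim_root; first by move: p_gt2; lia.
  - apply/allP => x; rewrite mem_filter => /andP[x0 _].
    by rewrite unity_rootE u1.
  - by rewrite filter_uniq // enum_uniq.
  rewrite size_filter -(leq_add2l (count (pred1 0) (enum 'F_p))).
  rewrite (count_predC (pred1 0)) -cardT card_Fp // count_uniq_mem ?enum_uniq //.
  by rewrite mem_enum inE addnC; move: p_gt2; lia.
have [i yi] := prim_rootP z_prim (u1 y y0).
move: yh; rewrite yi -exprM => /eqP; rewrite -(prim_order_dvd z_prim) => hd.
have /dvdnP[j ij] : (2 %| i)%N.
  by rewrite -(dvdn_pmul2r h_gt0) (_ : (2 * h)%N = p.-1) //; move: p_eq; lia.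
exists (z ^+ j : 'F_p); rewrite -intF_eq0 mulrzBr subr_eq0 rmorphXn /=.
by rewrite -pmulrn natr_Zp -exprM -ij -yi.
Qed.


(** * Gauss's lemma and quadratic reciprocity *)

Section Gauss.
Variable a : nat.
Hypothesis cop : coprime p a.

(** Tells whether the residue of [a i] of least absolute value is negative; [f i] below is that
    absolute value. *)
Definition gauss_neg (i : nat) : bool := (h < a * i %% p)%N.

Let f i := (if gauss_neg i then p - a * i %% p else a * i %% p)%N.

Let fE i : ((f i)%:R : 'F_p) = (-1) ^+ gauss_neg i * (a%:R * i%:R).
Proof.
rewrite /f; case: ifP => _; rewrite ?expr1 ?expr0 ?mul1r -?natrM; last first.
  by rewrite Fp_nat_mod.
by rewrite natrB ?(ltnW (ltn_pmod _ _)) ?prime_gt0 // pchar_Fp_0 // sub0r mulN1r Fp_nat_mod.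
Qed.

(** If [f i = f j] then [i = j] or [i = -j] modulo [p], and the latter is excluded by
    [0 < i + j < p]. *)
Let f_perm : perm_eq [seq f i | i <- index_iota 1 h.+1] (index_iota 1 h.+1).
Proof.
have aF : (a%:R : 'F_p) != 0 by rewrite natF_eq0 -prime_coprime.
have f_rng i : (0 < i < h.+1)%N -> (0 < f i < h.+1)%N.
  move=> ih; have : (f i)%:R != 0 :> 'F_p.
    rewrite fE mulf_neq0 ?signr_eq0 // mulf_neq0 // natF_eq0.
    by apply/negP => /dvdn_leq; move: p_eq ih; lia.
  have lt : (a * i %% p < p)%N by rewrite ltn_pmod ?prime_gt0.
  rewrite /f /gauss_neg; case: ltnP => hlt; rewrite natF_eq0 => nz.
    by move: p_eq; lia.
  case: (posnP (a * i %% p)) nz => [->|]; rewrite ?dvdn0 //.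
have f_inj : {in index_iota 1 h.+1 &, injective f}.
  move=> i j; rewrite !mem_index_iota => ih jh /(congr1 (fun n => n%:R : 'F_p)).
  rewrite !fE !mulrA ![_ * a%:R]mulrC -!mulrA => /(mulfI aF) e.
  have : ((i%:R : 'F_p) == j%:R) || ((i%:R : 'F_p) == - j%:R).
    move: e; case: (gauss_neg i); case: (gauss_neg j);
      rewrite ?expr0 ?expr1 ?mul1r ?mulN1r.
    - by move/oppr_inj => ->; rewrite eqxx.
    - by move/eqP; rewrite eqr_oppLR => ->; rewrite orbT.
    - by move=> ->; rewrite eqxx orbT.
    - by move=> ->; rewrite eqxx.
  case/orP; last first.
    rewrite -subr_eq0 opprK -natrD natF_eq0 => /dvdn_leq; move: p_eq ih jh; lia.
  have := intF_eq0 (i%:Z - j%:Z); rewrite mulrzBr subr_eq0 => -> /dvdn_leq.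
  by move: p_eq ih jh; lia.
have f_uniq : uniq [seq f i | i <- index_iota 1 h.+1].
  by rewrite map_inj_in_uniq // iota_uniq.
apply: uniq_perm => //; first exact: iota_uniq.
apply: (uniq_min_size f_uniq _ _).2; last by rewrite size_map.
by move=> x /mapP[i]; rewrite !mem_index_iota => /f_rng hi ->.
Qed.

Lemma gauss_lemma : legendre p a = (-1) ^+ (\sum_(1 <= i < h.+1) gauss_neg i).
Proof.
apply: intF_inj; rewrite ?legendre_le1 ?normrX ?normrN1 ?expr1n //.
rewrite legendreE rmorphXn /= rmorphN1.
set S := (\sum_(_ <= _ < _) _)%N; set P : 'F_p := \prod_(1 <= i < h.+1) i%:R.
have P0 : P != 0.
  rewrite prodf_seq_neq0; apply/allP => i; rewrite mem_index_iota => ih /=.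
  by rewrite natF_eq0; apply/negP => /dvdn_leq; move: p_eq ih; lia.
have : P = (-1) ^+ S * (a%:R ^+ h * P).
  rewrite {1}/P -(perm_big _ f_perm) big_map /= (eq_bigr _ (fun i _ => fE i)).
  rewrite big_split /= big_split /= prodrXr; congr (_ * (_ * _)).
  by rewrite prodr_const_nat subn1.
move=> eP; have e : (-1) ^+ S * (a%:R : 'F_p) ^+ h = 1.
  by apply: (mulIf P0); rewrite mul1r -mulrA -eP.
by rewrite -[LHS](signrMK S) /= e mulr1.
Qed.

Lemma gauss_lemma_floor : odd a ->
  legendre p a = (-1) ^+ (\sum_(1 <= i < h.+1) (a * i %/ p)).
Proof.
move=> a_odd; rewrite gauss_lemma -[LHS]signr_odd -[RHS]signr_odd; congr (_ ^+ _).
(* Modulo 2, the division of [a i] by [p], with [a] and [p] odd, makes each summand even; the sums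
   of [f i] and of [i] then cancel because [f] permutes the range. *)
have : ~~ odd (\sum_(1 <= i < h.+1) (f i + i + gauss_neg i + a * i %/ p)).
  elim/big_ind: _ => [//|m n hm hn|i _]; first by rewrite oddD (negbTE hm) (negbTE hn).
  rewrite !oddD oddb; have := congr1 odd (divn_eq (a * i) p).
  rewrite oddD !oddM a_odd p_odd /= andbT => ->; rewrite /f.
  have lt : (a * i %% p < p)%N by rewrite ltn_pmod ?prime_gt0.
  case: ifP => _; rewrite ?(oddB (ltnW lt)) ?p_odd /=;
  by do 2 case: (odd _).
have sum_f : (\sum_(1 <= i < h.+1) f i = \sum_(1 <= i < h.+1) i)%N.
  by rewrite -[RHS](perm_big _ f_perm) big_map.
rewrite !big_split /= sum_f addnn !oddD odd_double /=.
by do 2 case: (odd _).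
Qed.
End Gauss.

Lemma legendre_2 : legendre p 2 = (-1) ^+ (h - h./2).
Proof.
rewrite (@gauss_lemma 2); last by rewrite prime_coprime // gtnNdvd.
congr (_ ^+ _).
have aux n : (\sum_(1 <= i < n.+1) (h < 2 * i))%N = (n - h./2)%N.
  elim: n => [|n IH]; first by rewrite big_geq.
  by rewrite big_nat_recr //= IH; lia.
rewrite -aux; apply: eq_big_nat => i ih.
by rewrite /gauss_neg modn_small //; move: p_eq; lia.
Qed.
End Legendre.

Lemma sum_leq_indicator (n t : nat) : (t <= n)%N ->
  (\sum_(1 <= j < n.+1) (j <= t))%N = t.
Proof.
elim: n => [|n IH] tn; first by rewrite big_geq //; lia.
rewrite big_nat_recr //=; case: (leqP t n) => lt.
  by rewrite IH //; lia.
rewrite (eq_big_nat _ _ (F2 := fun=> 1%N)) ?sum_nat_const_nat; first by lia.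
by move=> j; lia.
Qed.

(** Eisenstein's count: the two floor sums count the lattice points of a rectangle on either side of
    its diagonal. *)
Theorem quadratic_reciprocity (p q : nat) :
  prime p -> odd p -> prime q -> odd q -> p != q ->
  legendre p q * legendre q p = (-1) ^+ (p.-1./2 * q.-1./2).
Proof.
move=> pp po qp qo pq.
have cop : coprime p q by rewrite prime_coprime // dvdn_prime2.
rewrite (gauss_lemma_floor pp po cop qo) (gauss_lemma_floor qp qo _ po) 1?coprime_sym //.
rewrite -exprD; congr (_ ^+ _).
have fl (m n i : nat) : odd m -> odd n -> (0 < i < m.-1./2.+1)%N ->
    (n * i %/ m)%N = (\sum_(1 <= j < n.-1./2.+1) (m * j <= n * i))%N.
  move=> mo no ih.
  rewrite -[LHS](@sum_leq_indicator n.-1./2).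
    by apply: eq_big_nat => j _; rewrite leq_divRL 1?mulnC //; lia.
  rewrite -ltnS ltn_divLR; last by lia.
  nia.
rewrite (eq_big_nat _ _ (fun i ih => fl _ _ i po qo ih)).
rewrite (eq_big_nat _ _ (fun i ih => fl _ _ i qo po ih)).
rewrite [X in (_ + X)%N]exchange_big_nat -big_split /=.
rewrite (eq_big_nat _ _ (F2 := fun=> q.-1./2)) ?sum_nat_const_nat ?subn1 //.
move=> i ih; rewrite -big_split /= (eq_big_nat _ _ (F2 := fun=> 1%N)).
  by rewrite sum_nat_const_nat subn1 muln1.
(* No lattice point lies on the diagonal: [p j = q i] would make [p] divide [i < p]. *)
move=> j jh; case: ltngtP => //= e.
have : (p %| q * i)%N by rewrite -e dvdn_mulr.
by rewrite Gauss_dvdr // => /dvdn_leq; lia.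
Qed.

(** * Multiplicative extension and the quadratic character of [-N] *)

Lemma nat_prime_ind (P : nat -> Prop) : P 1%N ->
  (forall p n, prime p -> (0 < n)%N -> P n -> P (p * n)%N) ->
  forall n, (0 < n)%N -> P n.
Proof.
move=> P1 PM; elim/ltn_ind => n IH n_gt0.
case: (ltnP 1 n) => [n_gt1|]; last by move: n_gt0; case: n {IH} => [|[]].
have p_pr := pdiv_prime n_gt1; have pn := pdiv_dvd n.
rewrite -(divnK pn) mulnC.
have q_gt0 : (0 < n %/ pdiv n)%N by rewrite divn_gt0 ?prime_gt0 // dvdn_leq.
by apply: PM => //; apply: IH => //; rewrite ltn_Pdiv ?prime_gt1.
Qed.

Definition mult_ext (R : comNzRingType) (g : nat -> R) (n : nat) : R :=
  \prod_(l <- primes n) g l ^+ logn l n.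

Section MultExt.
Variable R : comNzRingType.
Implicit Type g : nat -> R.

Lemma mult_ext_widen g n B : (0 < n < B)%N ->
  mult_ext g n = \prod_(0 <= l < B | prime l) g l ^+ logn l n.
Proof.
move=> /andP[n0 nB]; rewrite [RHS](bigID (fun l => l \in primes n)) /=.
rewrite [X in _ * X]big1 ?mulr1 => [|l /andP[_ ln]]; last first.
  by move: ln; rewrite -logn_gt0 -eqn0Ngt => /eqP ->.
rewrite /mult_ext -[RHS]big_filter; apply: perm_big; apply: uniq_perm.
- exact: primes_uniq.
- by rewrite filter_uniq // iota_uniq.
move=> l; rewrite mem_filter mem_index_iota !mem_primes n0 /=.
case: (boolP (prime l)) => //= _; case: (boolP (l %| n)%N) => //= /(dvdn_leq n0).
by lia.
Qed.

Lemma mult_ext1 g : mult_ext g 1 = 1.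
Proof. by rewrite /mult_ext big_nil. Qed.

Lemma mult_ext_prime g p : prime p -> mult_ext g p = g p.
Proof.
by move=> pp; rewrite /mult_ext primes_prime // big_seq1 logn_prime // eqxx expr1.
Qed.

Lemma mult_extM g m n : (0 < m)%N -> (0 < n)%N ->
  mult_ext g (m * n) = mult_ext g m * mult_ext g n.
Proof.
move=> m0 n0; have mn0 : (0 < m * n)%N by rewrite muln_gt0 m0.
rewrite !(@mult_ext_widen _ _ (m * n).+1) ?m0 ?n0 ?mn0 /= ?ltnS ?leq_pmull ?leq_pmulr //.
by rewrite -big_split; apply: eq_bigr => l _; rewrite lognM // exprD.
Qed.

Lemma mult_ext_id g n : g 1%N = 1 -> {morph g : i j / (i * j)%N >-> i * j} ->
  (0 < n)%N -> mult_ext g n = g n.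
Proof.
move=> g1 gM; move: n; apply: nat_prime_ind; first by rewrite mult_ext1.
by move=> p n pp n0 IH; rewrite mult_extM ?(prime_gt0 pp) // mult_ext_prime // gM IH.
Qed.

Lemma eq_mult_ext g g' n : {in primes n, g =1 g'} -> mult_ext g n = mult_ext g' n.
Proof. by move=> e; apply: eq_big_seq => l /e ->. Qed.

Lemma mult_ext_split g g' n :
  mult_ext (fun l => g l * g' l) n = mult_ext g n * mult_ext g' n.
Proof. by rewrite -big_split; apply: eq_bigr => l _; rewrite exprMn. Qed.
End MultExt.

(** [chi4] and [chi8] give the Legendre symbols of -1 and of 2 modulo odd primes. *)
Definition chi4 (k : nat) : int :=
  if odd k then if (k %% 4 == 1)%N then 1 else -1 else 0.

Definition chi8 (k : nat) : int :=
  if odd k then if (k %% 8 == 1)%N || (k %% 8 == 7)%N then 1 else -1 else 0.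

Lemma chi4M j k : chi4 (j * k) = chi4 j * chi4 k.
Proof.
have c n : chi4 n = chi4 (n %% 4) by rewrite /chi4 modn_mod odd_mod.
rewrite c -modnMm (c j) (c k).
have := ltn_pmod j (isT : 0 < 4)%N; have := ltn_pmod k (isT : 0 < 4)%N.
by move: (j %% 4)%N (k %% 4)%N => [|[|[|[|j']]]] [|[|[|[|k']]]].
Qed.

Lemma chi8M j k : chi8 (j * k) = chi8 j * chi8 k.
Proof.
have c n : chi8 n = chi8 (n %% 8) by rewrite /chi8 modn_mod odd_mod.
rewrite c -modnMm (c j) (c k).
have := ltn_pmod j (isT : 0 < 8)%N; have := ltn_pmod k (isT : 0 < 8)%N.
by move: (j %% 8)%N (k %% 8)%N => [|[|[|[|[|[|[|[|j']]]]]]]] [|[|[|[|[|[|[|[|k']]]]]]]].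
Qed.

(* [local_char l k] is the Legendre symbol of [l] modulo [k] when [k] is an odd prime, rewritten
   through reciprocity so as to be visibly periodic in [k]. *)
Definition local_char (l k : nat) : int :=
  if l == 2%N then chi8 k else legendre l k * chi4 k ^+ l.-1./2.

(** The symbol of [-N] in periodic form: [chi4] accounts for -1 and the product for [N]. *)
Definition chi (N k : nat) : int := chi4 k * mult_ext (local_char^~ k) N.

Lemma normr_prod_le1 (I : eqType) (s : seq I) (F : I -> int) :
  (forall i, `|F i| <= 1) -> `|\prod_(i <- s) F i| <= 1.
Proof.
move=> hF; elim/big_ind: _ => // x y hx hy.
by rewrite normrM mulr_ile1.
Qed.

Lemma chi_le1 N k : `|chi N k| <= 1.
Proof.
have h4 : `|chi4 k| <= 1 by rewrite /chi4; do ?case: ifP.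
rewrite normrM mulr_ile1 // normr_prod_le1 // => l.
rewrite normrX exprn_ile1 // /local_char; case: ifP => _.
  by rewrite /chi8; do ?case: ifP.
by rewrite normrM mulr_ile1 ?legendre_le1 // normrX exprn_ile1.
Qed.

Lemma mem_primes_odd l N : l \in primes N -> prime l /\ (l != 2%N -> odd l).
Proof.
rewrite mem_primes => /and3P[pl _ _]; split=> // l2.
by case: (even_prime pl) l2 => [->|].
Qed.

Lemma chiM N j k : chi N (j * k) = chi N j * chi N k.
Proof.
rewrite /chi mulrACA -mult_ext_split chi4M; congr (_ * _).
apply: eq_mult_ext => l /mem_primes_odd[pl lo]; rewrite /local_char.
case: eqP lo => [_ _|_ /(_ isT) lo]; first by rewrite chi8M.
by rewrite PoszM legendreM // chi4M exprMn mulrACA.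
Qed.

Lemma chi1 N : chi N 1 = 1.
Proof.
rewrite /chi /mult_ext mul1r big1_seq // => l /andP[_ /mem_primes_odd[pl lo]].
rewrite /local_char; case: eqP lo => [_ _|_ /(_ isT) lo]; first by rewrite expr1n.
by rewrite legendre1 mul1r !expr1n.
Qed.

(** The period [4 N] also suffices for [chi8], which occurs only when [N] is even, so that 8 divides
    [4 N]. *)
Lemma chi_mod N j k : j = k %[mod 4 * N] -> chi N j = chi N k.
Proof.
move=> e.
have em d : (d %| 4 * N)%N -> j = k %[mod d].
  by move=> dN; rewrite -(modn_dvdm j dN) e modn_dvdm.
have e4 := em 4%N (dvdn_mulr _ (dvdnn _)).
have o : odd j = odd k.
  by have := congr1 odd e4; rewrite !odd_mod.
have c4 : chi4 j = chi4 k by rewrite /chi4 e4 o.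
rewrite /chi c4; congr (_ * _); apply: eq_mult_ext => l lN.
have [pl lo] := mem_primes_odd lN; rewrite /local_char c4.
have dN : (l %| N)%N by move: lN; rewrite mem_primes => /and3P[].
case: eqP dN lo => [-> dN _|_ dN /(_ isT) lo].
  by rewrite /chi8 o (em 8) // (@dvdn_pmul2l 4 2).
congr (_ * _); apply: legendre_mod => //.
have /eqP := em l (dvdn_mull _ dN).
case: (leqP k j) => kj.
  by rewrite eqn_mod_dvd // subzn.
by rewrite eq_sym eqn_mod_dvd 1?ltnW // distnC subzn 1?ltnW.
Qed.


Lemma chi4_odd (k : nat) : odd k -> chi4 k = (-1) ^+ k.-1./2.
Proof.
move=> ko; rewrite /chi4 ko -signr_odd.
by case: eqP => h4; [rewrite (_ : odd _ = false) // | rewrite (_ : odd _ = true) //]; lia.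
Qed.

Lemma legendre_mult_ext p (N : nat) : prime p -> odd p -> (0 < N)%N ->
  legendre p N = mult_ext (fun l => legendre p l%:Z) N.
Proof.
move=> pp po N0; rewrite (mult_ext_id _ _ N0) ?legendre1 // => i j.
by rewrite PoszM legendreM.
Qed.

Lemma local_char_prime l p : prime l -> prime p -> odd p -> p != l ->
  local_char l p = legendre p l.
Proof.
move=> pl pp po pl_neq; rewrite /local_char; case: eqVneq => [->|l2].
  rewrite legendre_2 // /chi8 po -signr_odd.
  case: ifP => h8; [rewrite (_ : odd _ = false) // | rewrite (_ : odd _ = true) //]; lia.
have lo : odd l by case: (even_prime pl) l2 => // ->.
have := quadratic_reciprocity pp po pl lo pl_neq.
rewrite chi4_odd // -exprM mulnC => <-.
have nd : ~~ (l %| p)%N by rewrite dvdn_prime2 // eq_sym.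
by rewrite mulrC -mulrA legendre_sq // mulr1.
Qed.

Lemma chi_prime N p : (0 < N)%N -> prime p -> coprime p (4 * N) ->
  chi N p = legendre p (- N%:Z).
Proof.
move=> N0 pp; rewrite coprimeMr => /andP[p4 pN].
have po : odd p.
  by case: (even_prime pp) p4 => // ->.
rewrite -mulN1r legendreM // legendreN1 // /chi chi4_odd //; congr (_ * _).
rewrite legendre_mult_ext //; apply: eq_mult_ext => l lN.
have [pl _] := mem_primes_odd lN; apply: local_char_prime => //.
apply: contraTneq pN => e; rewrite prime_coprime // e negbK.
by move: lN; rewrite mem_primes => /and3P[].
Qed.

(** * Residue classes on which the character is 1, and the moduli they provide *)

Lemma chi_residue_coprime3 (n a : nat) : (0 < n)%N ->
  a.+1 = 0 %[mod 4 * n] -> a = 1 %[mod 3] -> ~~ (3 %| n)%N -> chi (3 * n) a = 1.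
Proof.
move=> n0 ha ha3 n3.
have d4n : (4 * n %| a.+1)%N by rewrite /dvdn ha mod0n.
have a4 : (4 %| a.+1)%N := dvdn_trans (dvdn_mulr _ (dvdnn 4)) d4n.
have a_odd : odd a by move: a4; lia.
have c4 : chi4 a = -1 by rewrite /chi4 a_odd; case: eqP => //; move: a4; lia.
rewrite /chi mult_extM // mult_ext_prime // {1}/local_char /= c4.
rewrite (@legendre_mod 3 _ a 1) //; last first.
  by move/eqP: ha3; case: a {ha d4n a4 a_odd c4} => // a; rewrite eqn_mod_dvd // subzn.
rewrite legendre1 mul1r ?expr1 mulrA mulrNN !mul1r /mult_ext big1_seq // => l /andP[_ ln].
(* The signs of [chi4 a] and of the factor at 3 have cancelled. Each prime [l] of [n] contributes 1:
   if odd, because [a = -1] modulo [l] and [chi4 a = -1]; if 2, because [a = 7] modulo 8. *)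
have [pl lo] := mem_primes_odd ln.
have la : (l %| a.+1)%N.
  by apply: dvdn_trans d4n; apply: dvdn_mull; move: ln; rewrite mem_primes => /and3P[].
rewrite /local_char; case: eqVneq lo ln => [-> _|l2 /(_ isT) lo] ln.
  have : (8 %| a.+1)%N.
    apply: dvdn_trans d4n; rewrite (@dvdn_pmul2l 4 2) //.
    by move: ln; rewrite mem_primes => /and3P[].
  rewrite /chi8 a_odd => a8; rewrite (_ : (_ || _)) ?expr1n //.
  by apply/orP; right; move: a8; clear; lia.
rewrite (@legendre_mod l pl a (-1)); last by rewrite opprK -PoszD addn1.
by rewrite legendreN1 // c4 -exprMn mulrNN mulr1 !expr1n.
Qed.

(** Both factors at 3 are 1. A prime [l] of [m] contributes the symbol of [-3] modulo [l], or -1 for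
    [l = 2], which is the symbol of [l] modulo 3; their product is the symbol of [m], that is 1. *)
Lemma chi_residue_triple (m a : nat) : (0 < m)%N ->
  a + 3 = 0 %[mod 4 * m] -> a = 1 %[mod 3] -> m = 1 %[mod 3] -> chi (9 * m) a = 1.
Proof.
move=> m0 ha ha3 m3.
have d4m : (4 * m %| a + 3)%N by rewrite /dvdn ha mod0n.
have a4 : (4 %| a + 3)%N := dvdn_trans (dvdn_mulr _ (dvdnn 4)) d4m.
have a_odd : odd a by move: a4; lia.
have c4 : chi4 a = 1 by rewrite /chi4 a_odd; case: eqP => //; move: a4; lia.
have l3 (k : nat) : k = 1 %[mod 3] -> legendre 3 k = 1.
  move=> k3; rewrite (@legendre_mod 3 _ k 1) // ?legendre1 //.
  by move/eqP: k3; case: k => // k; rewrite eqn_mod_dvd // subzn.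
rewrite /chi c4 mul1r (mult_extM _ (isT : 0 < 9)%N m0) (@mult_extM _ _ 3 3) //.
rewrite mult_ext_prime // {1 2}/local_char /= c4 !l3 // !(expr1n, mul1r).
transitivity (mult_ext (fun l => legendre 3 l%:Z) m); last first.
  by rewrite -legendre_mult_ext // l3.
apply: eq_mult_ext => l lm; have [pl lo] := mem_primes_odd lm.
have lm' : (l %| m)%N by move: lm; rewrite mem_primes => /and3P[].
have l_neq3 : l != 3%N by apply: contra_eqN m3 => /eqP e; move: lm'; rewrite e; lia.
have la : (l %| a + 3)%N by apply: dvdn_trans d4m; apply: dvdn_mull.
rewrite /local_char; case: eqVneq lo lm lm' => [-> _|l2 /(_ isT) lo] lm lm'.
  have : (8 %| a + 3)%N by apply: dvdn_trans d4m; rewrite (@dvdn_pmul2l 4 2).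
  rewrite /chi8 a_odd => a8; rewrite (_ : (_ || _) = false); last by move: a8; clear; lia.
  by rewrite /legendre.
rewrite (@legendre_mod l pl a (-3)); last by rewrite opprK -PoszD.
rewrite c4 expr1n mulr1 (_ : (-3 : int) = -1 * 3%:Z) // legendreM // legendreN1 //.
rewrite -[3%:Z]/(Posz 3) -(@local_char_prime 3 l) // /local_char /= chi4_odd // expr1 mulrCA.
by rewrite -signr_odd; case: (odd _); rewrite ?mulrNN !mulr1.
Qed.

(** Remove [p^2] into the square part as long as possible; the primes left have odd exponent in [q],
    and their square roots of [-N] are glued by the Chinese remainder theorem. *)
Lemma exists_squarefree_split (N q : nat) : (0 < q)%N ->
  (forall p, prime p -> odd (logn p q) -> exists x, (p %| x ^ 2 + N)%N) ->
  exists q0 s B, [/\ (0 < q0)%N, q = (q0 * s ^ 2)%N & (q0 %| B ^ 2 + N)%N].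
Proof.
elim/ltn_ind: q => q IH q0 hq; case: (ltnP 1 q) => q1; last first.
  by exists 1%N, 1%N, 0%N; split; rewrite ?dvd1n //; lia.
have pp := pdiv_prime q1; set p := pdiv q in pp *; have p0 := prime_gt0 pp.
case: (boolP (p ^ 2 %| q)%N) => [/dvdnP[q' qE]|p2].
  have q'0 : (0 < q')%N by move: q0; rewrite qE muln_gt0 => /andP[].
  have q'q : (q' < q)%N by rewrite qE ltn_Pmulr // -{1}(expn0 p) ltn_exp2l ?prime_gt1.
  have [|r [s [B [r0 q'E rB]]]] := IH q' q'q q'0.
    move=> l lp ol; apply: hq => //.
    by rewrite qE lognM // ?expn_gt0 ?p0 // lognX oddD oddM addbF.
  by exists r, (p * s)%N, B; split=> //; rewrite qE q'E expnMn; ring.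
have /dvdnP[q' qE] : (p %| q)%N by exact: pdiv_dvd.
have q'0 : (0 < q')%N by move: q0; rewrite qE muln_gt0 => /andP[].
have q'q : (q' < q)%N by rewrite qE ltn_Pmulr // prime_gt1.
have pq' : coprime p q'.
  rewrite prime_coprime //; apply: contra p2 => pq'.
  by rewrite qE mulnC -mulnn dvdn_pmul2l.
have lg' : logn p q' = 0%N by apply: logn_coprime.
have lg l : logn l q = (logn l q' + (l == p))%N.
  by rewrite qE lognM // (logn_prime _ pp).
have [|r [s [B [r0 q'E rB]]]] := IH q' q'q q'0.
  move=> l lp ol; apply: hq => //; rewrite lg.
  by case: eqP ol => [->|_]; rewrite ?lg' // addn0.
have pr : coprime p r by apply: coprime_dvdr pq'; rewrite q'E dvdn_mulr.
have [x px] : exists x, (p %| x ^ 2 + N)%N by apply: hq; rewrite ?lg ?lg' ?eqxx.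
exists (p * r)%N, s, (chinese p r x B); split.
- by rewrite muln_gt0 p0.
- by rewrite qE q'E; ring.
rewrite Gauss_dvd // /dvdn -(modnDml _ N p) -(modnDml _ N r) -(modnXm 2 p) -(modnXm 2 r).
by rewrite chinese_modl // chinese_modr // !modnXm !modnDml; apply/andP.
Qed.

(** For a prime [p] of odd exponent in [q], a nonzero divisor sum excludes [chi N p = -1], and
    [chi N q = 1] excludes 0. So [-N] is a square modulo [p]. *)
Lemma exists_split_modulus (N a : nat) : (0 < N)%N -> coprime a (4 * N) -> chi N a = 1 ->
  exists q s B, [/\ (0 < q)%N, (q * s ^ 2)%N = a %[mod 4 * N] & (q %| B ^ 2 + N)%N].
Proof.
move=> N0 aN chia.
have M1 : (1 < 4 * N)%N by lia.
have [q [q0 qa rq]] :=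
  exists_divisor_sum_neq0 (chi1 N) (chiM N) (chi_le1 N) (@chi_mod N) M1 aN chia.
have [|r [s [B [r0 qE rB]]]] := @exists_squarefree_split N q q0; last first.
  by exists r, s, B; rewrite -qE.
move=> p pp o; have pN1 := divisor_sum_neq0 (chi1 N) (chiM N) q0 pp rq o.
have pq : (p %| q)%N.
  by move: o; case: (posnP (logn p q)) => [->//|]; rewrite logn_gt0 mem_primes => /and3P[].
have pN : coprime p (4 * N).
  by apply: coprime_dvdl pq _; rewrite -coprime_modl qa coprime_modl.
have p0 : chi N p != 0.
  have : chi N q = 1 by rewrite (chi_mod qa).
  case/dvdnP: pq => t ->; rewrite chiM; case: eqP => // ->.
  by rewrite mulr0 => /eqP.
have : chi N p = 1 by move: (chi_le1 N p) pN1 p0; lia.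
have po : odd p.
  by move: pN; rewrite coprimeMr => /andP[]; case: (even_prime pp) => // ->.
rewrite chi_prime // => /(legendre_square pp po) [x]; rewrite opprK -rmorphXn -PoszD /=.
by exists x.
Qed.

Lemma exists_residue_coprime3 (n : nat) : (0 < n)%N -> ~~ (3 %| n)%N ->
  exists a, [/\ coprime a (4 * (3 * n)), a.+1 = 0 %[mod 4 * n] & chi (3 * n) a = 1].
Proof.
move=> n0 n3; have [a a3 ha] : exists2 a, a = 1 %[mod 3] & a.+1 = 0 %[mod 4 * n].
  (* Both [8 n - 1] and [4 n - 1] are -1 modulo [4 n]; the residue of [n] modulo 3 decides which one
     is 1 modulo 3. *)
  case: (eqVneq (n %% 3)%N 1%N) => hn.
    exists (8 * n - 1)%N; first by lia.
    by rewrite (_ : (8 * n - 1).+1 = 2 * (4 * n))%N ?modnMl ?mod0n //; lia.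
  exists (4 * n - 1)%N; first by lia.
  by rewrite (_ : (4 * n - 1).+1 = (4 * n))%N ?modnn ?mod0n //; lia.
exists a; split=> //; last exact: chi_residue_coprime3.
rewrite mulnCA coprimeMr -coprime_modl a3 /=.
have d : (4 * n %| a.+1)%N by rewrite /dvdn ha mod0n.
by apply: coprime_dvdr d _; exact: coprimenS.
Qed.

Lemma exists_residue_triple (m : nat) : m = 1 %[mod 3] ->
  exists a, [/\ coprime a (4 * (9 * m)), a + 3 = 0 %[mod 4 * m], a = 1 %[mod 3]
    & chi (9 * m) a = 1].
Proof.
move=> m3; have m0 : (0 < m)%N by case: m m3.
pose a := (4 * m - 3)%N; exists a.
have a3 : a = 1 %[mod 3] by rewrite /a; lia.
have e : (a + 3 = 4 * m)%N by rewrite /a; lia.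
have am : a + 3 = 0 %[mod 4 * m] by rewrite e modnn mod0n.
split=> //; last exact: chi_residue_triple.
have c3 : coprime a 3 by rewrite -coprime_modl a3.
rewrite mulnCA (_ : 9 = 3 * 3)%N // !coprimeMr c3 /= -coprimeMr -e.
by rewrite /coprime gcdnDl.
Qed.

(** * Reduction of ternary forms *)

Open Scope Z_scope.

Definition tern (a b c r s t u v w : Z) : Z :=
  a * u^2 + b * v^2 + c * w^2 + r * u * v + s * u * w + t * v * w.

Definition hexrep (n : Z) : Prop := exists x z w : Z, n = x^2 + (z^2 + z*w + w^2).

Lemma centered_residue (r m : Z) : 0 < m -> exists k, - m <= 2 * (r + k * m) <= m.
Proof.
intros Hm. exists (- ((2 * r + m) / (2 * m))).
pose proof (Z.div_mod (2 * r + m) (2 * m) ltac:(lia)).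
pose proof (Z.mod_pos_bound (2 * r + m) (2 * m) ltac:(lia)).
nia.
Qed.

(** The bounds force [b = 1] and [r, s, t] in {-1, 0, 1}. In the cases compatible with the
    discriminant [c = 1], and permuting the variables with a change of sign gives [f]. *)
Lemma tern_reduced (b c r s t u v w : Z) :
  -1 <= r <= 1 -> -1 <= s <= 1 ->
  0 < 4 * b - r^2 <= 4 ->
  - (4 * b - r^2) <= 2 * (2 * t - r * s) <= 4 * b - r^2 ->
  4 * b * c + r * s * t - t^2 - b * s^2 - c * r^2 = 3 ->
  hexrep (tern 1 b c r s t u v w).
Proof.
intros Hr Hs HA HB Hd.
assert (Hb : b = 1) by nia.
subst b.
assert (Ht : -1 <= t <= 1) by nia.
assert (Hrc : r = -1 \/ r = 0 \/ r = 1) by lia.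
assert (Hsc : s = -1 \/ s = 0 \/ s = 1) by lia.
assert (Htc : t = -1 \/ t = 0 \/ t = 1) by lia.
unfold hexrep, tern.
destruct Hrc as [-> | [-> | ->]]; destruct Hsc as [-> | [-> | ->]];
destruct Htc as [-> | [-> | ->]]; try lia;
assert (c = 1) by lia; subst c.
all: first [ now (exists w, u, v; ring) | now (exists w, u, (-v); ring)
 | now (exists v, u, w; ring) | now (exists v, u, (-w); ring)
 | now (exists u, v, w; ring) | now (exists u, v, (-w); ring) ].
Qed.

(* The two projected minors [A = 4ab - r^2] and [C = 4ac - s^2] are the outer coefficients of the
   binary form orthogonal to the first basis vector; the reduction is lexicographic in [(a, A)]. *)
Lemma tern_disc3 (a b c r s t : Z) :
  0 < a -> 0 < 4 * a * b - r^2 ->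
  4 * a * b * c + r * s * t - a * t^2 - b * s^2 - c * r^2 = 3 ->
  forall u v w, hexrep (tern a b c r s t u v w).
Proof.
intros Ha. apply Z.le_succ_l in Ha. revert b c r s t. pattern a. revert a Ha.
apply (Zlt_lower_bound_ind _ 1). intros a IHa Ha b c r s t HA.
remember (4 * a * b - r^2) as A eqn:EA. apply Z.le_succ_l in HA.
revert b c r s t EA. pattern A. revert A HA.
apply (Zlt_lower_bound_ind _ 1). intros A IHA HA' b c r s t EA Hd u v w.
assert (HA : 0 < A) by lia.
(* Adding [k] times the second basis vector to the third preserves [a], [b], [r], [A] and centres
   [B] modulo [A]. *)
destruct (@centered_residue (2 * a * t - r * s) A HA) as [k Hk].
set (s1 := s + k * r). set (t1 := t + 2 * k * b). set (c1 := c + k * t + k^2 * b).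
assert (Hd1 : 4 * a * b * c1 + r * s1 * t1 - a * t1^2 - b * s1^2 - c1 * r^2 = 3)
  by (unfold s1, t1, c1; rewrite <- Hd; ring).
assert (HB1 : - A <= 2 * (2 * a * t1 - r * s1) <= A).
{ replace (2 * a * t1 - r * s1) with (2 * a * t - r * s + k * A); [exact Hk|].
  unfold t1, s1. rewrite EA. ring. }
replace (tern a b c r s t u v w) with (tern a b c1 r s1 t1 u (v - k * w) w)
  by (unfold tern, s1, t1, c1; ring).
generalize (v - k * w). clear v. intro v.
clearbody s1 t1 c1. clear k Hk Hd s t c.
rename s1 into s, t1 into t, c1 into c.
set (B := 2 * a * t - r * s) in *. set (C := 4 * a * c - s^2).
assert (HABC : A * C = B^2 + 12 * a).
{ unfold B, C. rewrite EA. replace (12 * a) with (4 * a * 3) by ring. rewrite <- Hd1. ring. }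
assert (HC : 0 < C) by (clear -HA Ha HABC; clearbody B C; nia).
destruct (Z_lt_le_dec C A) as [HCA | HCA].
{ replace (tern a b c r s t u v w) with (tern a c b s r t u w v) by (unfold tern; ring).
  apply (IHA C); [lia | reflexivity |]. rewrite <- Hd1. ring. }
(* From [A <= C] and [2 |B| <= A]: [A^2 <= A C = B^2 + 12 a <= A^2 / 4 + 12 a]. *)
assert (HA16 : A * A <= 16 * a) by (clear -HA Ha HABC HB1 HCA; clearbody B C; nia).
(* Adding a multiple of the first basis vector to the second preserves [A] and [B] and gives
   [|r| <= a]. *)
destruct (@centered_residue r (2 * a) ltac:(lia)) as [k Hk].
set (r1 := r + k * (2 * a)) in *. set (b1 := b + k * r + k^2 * a). set (t1 := t + k * s).
assert (Hd2 : 4 * a * b1 * c + r1 * s * t1 - a * t1^2 - b1 * s^2 - c * r1^2 = 3)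
  by (unfold r1, t1, b1; rewrite <- Hd1; ring).
assert (EA1 : A = 4 * a * b1 - r1^2) by (unfold b1, r1; rewrite EA; ring).
assert (EB1 : B = 2 * a * t1 - r1 * s) by (unfold B, t1, r1; ring).
replace (tern a b c r s t u v w) with (tern a b1 c r1 s t1 (u - k * v) v w)
  by (unfold tern, r1, t1, b1; ring).
generalize (u - k * v). clear u. intro u.
clear HABC HC HCA. clear C. clearbody r1 b1 t1 B. clear Hd1 EA r b t.
rename b1 into b, r1 into r, t1 into t.
destruct (Z_lt_le_dec b a) as [Hba | Hba].
{ replace (tern a b c r s t u v w) with (tern b a c r t s v u w) by (unfold tern; ring).
  assert (0 < b) by nia.
  apply IHa; [lia | nia |]. rewrite <- Hd2. ring. }
(* Indeed [4 a^2 <= 4 a b = A + r^2 <= A + a^2]. With [A^2 <= 16 a] this gives [9 a^3 <= 16], hence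
   [a = 1]. *)
assert (H3 : 3 * (a * a) <= A) by nia.
assert (Ha1 : a = 1) by nia.
subst a.
destruct (@centered_residue s 2 ltac:(lia)) as [l Hl].
set (s1 := s + l * 2) in *. set (c1 := c + l * s + l^2). set (t1 := t + l * r).
replace (tern 1 b c r s t u v w) with (tern 1 b c1 r s1 t1 (u - l * w) v w)
  by (unfold tern, s1, t1, c1; ring).
apply tern_reduced; [lia | lia | | | unfold s1, t1, c1; rewrite <- Hd2; ring].
{ clear -EA1 HA HA16. assert (A <= 4) by nia. lia. }
replace (2 * t1 - r * s1) with B by (rewrite EB1; unfold t1, s1; ring). lia.
Qed.

(** * Forms with a prescribed first coefficient *)

Lemma hexrep_of_form (a b c r s t A B C : Z) : 0 < a -> 0 < A ->
  4 * a * b - r^2 = A -> 4 * a * c - s^2 = C -> 2 * a * t - r * s = B ->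
  A * C - B^2 = 12 * a -> hexrep a.
Proof.
intros Ha HA EA EC EB Hd.
replace a with (tern a b c r s t 1 0 0) by (unfold tern; ring).
apply tern_disc3; [exact Ha | lia |].
(* [A C - B^2] is [4 a] times the discriminant. *)
apply (Z.mul_reg_l _ _ (4 * a)); [lia|].
replace (4 * a * 3) with (12 * a) by ring. rewrite -Hd -EA -EB -EC. ring.
Qed.

(** The projected form is chosen with coefficients [q], [2 B], [4 e], so its determinant is [12 n].
    With [r = - q s] and [- 2 B s] for the [u w] coefficient, the other coefficients are quotients
    by [4 n] or [2 n], integral since [q s^2 = -1] modulo [4 n]. *)
Lemma hexrep_of_split (n q s B k e : Z) : 0 < n -> 0 < q ->
  q * s^2 = 4 * n * k - 1 -> q * e = B^2 + 3 * n -> hexrep n.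
Proof.
intros Hn Hq Hs He.
set (X := e + B^2 * s^2).
assert (HqX : q * X = n * (3 + 4 * k * B^2)).
{ unfold X. replace (q * (e + B^2 * s^2)) with (q * e + B^2 * (q * s^2)) by ring.
  rewrite Hs He. ring. }
(* Multiply [X] by [1 = 4 n k - q s^2], knowing that [n] divides [q X]; the cofactor is the
   coefficient [c]. *)
assert (HX : X = n * (4 * k * X - s^2 * (3 + 4 * k * B^2))).
{ replace (n * (4 * k * X - s^2 * (3 + 4 * k * B^2)))
    with (4 * n * k * X - s^2 * (n * (3 + 4 * k * B^2))) by ring.
  rewrite <- HqX. replace (s^2 * (q * X)) with (q * s^2 * X) by ring. rewrite Hs. ring. }
apply (@hexrep_of_form n (q * k) (4 * k * X - s^2 * (3 + 4 * k * B^2))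
  (- q * s) (- 2 * B * s) (4 * B * k) q (2 * B) (4 * e) Hn Hq).
- replace (4 * n * (q * k) - (- q * s)^2) with (q * (4 * n * k - q * s^2)) by ring.
  rewrite Hs. ring.
- replace (4 * n * (4 * k * X - s^2 * (3 + 4 * k * B^2)))
    with (4 * (n * (4 * k * X - s^2 * (3 + 4 * k * B^2)))) by ring.
  rewrite <- HX. unfold X. ring.
- replace (2 * n * (4 * B * k) - - q * s * (-2 * B * s))
    with (2 * B * (4 * n * k - q * s^2)) by ring.
  rewrite Hs. ring.
- replace (q * (4 * e)) with (4 * (q * e)) by ring. rewrite He. ring.
Qed.

(** Same construction, with projected coefficients [3 q], [18 u], [12 f] of determinant [36 m],
    where [q f = 9 u^2 + m]. *)
Lemma hexrep_triple_of_split (m i q s B k j e : Z) : 0 < m -> 0 < q -> m = 3 * i + 1 ->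
  q * s^2 = 4 * m * k - 3 -> q * s^2 = 1 + 3 * j -> q * e = B^2 + 9 * m ->
  hexrep (3 * m).
Proof.
intros Hm Hq Hi Hs Hj He.
(* This divides [B] by 9 modulo [q]: [9 u = B (3 j)^2], and [3 j = -1] modulo [q]. *)
set (u := B * j^2).
assert (Ef : exists f, q * f = 9 * u^2 + m).
{ (* modulo [q], [3 j = -1], hence [81 u^2 = B^2 = - 9 m] *)
  exists (9 * e * j^4 - m * s^2 * ((q * s^2 - 1)^3 - (q * s^2 - 1)^2 + (q * s^2 - 1) - 1)).
  replace (q * (9 * e * j^4 - m * s^2 * ((q * s^2 - 1)^3 - (q * s^2 - 1)^2 + (q * s^2 - 1) - 1)))
    with (9 * (q * e) * j^4 - m * ((q * s^2 - 1)^4 - 1)) by ring.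
  rewrite He. replace (q * s^2 - 1) with (3 * j) by lia. unfold u. ring. }
destruct Ef as [f Hf].
set (Q := q * s^2) in *.
assert (Eb : exists b, 3 * b = k + Q * (4 * m - 2)).
{ assert (Ek : k = 4 + 3 * j - 3 * (4 * i * k) - 3 * k) by (rewrite Hj Hi in Hs; clear -Hs; lia).
  rewrite Hj.
  exists (2 + j - 4 * i * k - k + 4 * i + j * (12 * i + 2)).
  rewrite Hi. clear -Ek. lia. }
destruct Eb as [b Hb].
set (X := f + 3 * u^2 * s^2).
assert (HqX : q * X = m * (1 + 12 * k * u^2)).
{ unfold X. replace (q * (f + 3 * u^2 * s^2)) with (q * f + 3 * u^2 * Q) by (unfold Q; ring).
  rewrite Hf Hs. ring. }
assert (Ec : exists c, m * c = X).
(* Since [m - 3 i = 1] and [3 = 4 m k - Q], [X = m X - i (4 m k - Q) X], where [Q X] is a multiple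
   of [m]. *)
{ exists (X - i * (4 * k * X - s^2 * (1 + 12 * k * u^2))).
  replace (m * (X - i * (4 * k * X - s^2 * (1 + 12 * k * u^2))))
    with (m * X - i * (4 * m * k * X - s^2 * (m * (1 + 12 * k * u^2)))) by ring.
  rewrite <- HqX. replace (s^2 * (q * X)) with (Q * X) by (unfold Q; ring).
  rewrite Hs. rewrite {1}Hi. ring. }
destruct Ec as [c Hc].
(* So the [u v] coefficient [q s (4 m - 1)] is congruent to [- q s] modulo [4 m] and divisible by
   3. *)
assert (Hg : 3 * (4 * i + 1) = 4 * m - 1) by (clear -Hi; lia).
apply (@hexrep_of_form (3 * m) (q * b) c
  (3 * q * s * (4 * i + 1)) (- 6 * u * s) (4 * u * (k - Q)) (3 * q) (18 * u) (12 * f));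
  [clear -Hm; lia | clear -Hq; lia | | | |].
- replace (3 * q * s * (4 * i + 1)) with (q * s * (4 * m - 1)) by (rewrite <- Hg; ring).
  replace (4 * (3 * m) * (q * b) - (q * s * (4 * m - 1))^2)
    with (q * (4 * m * (3 * b) - Q * (4 * m - 1)^2)) by (unfold Q; ring).
  rewrite Hb Hs. ring.
- replace (4 * (3 * m) * c) with (12 * (m * c)) by ring. rewrite Hc. unfold X. ring.
- replace (3 * q * s * (4 * i + 1) * (-6 * u * s))
    with (- 6 * u * Q * (3 * (4 * i + 1))) by (unfold Q; ring).
  rewrite Hg. replace (2 * (3 * m) * (4 * u * (k - Q)) - -6 * u * Q * (4 * m - 1))
   with (6 * u * (4 * m * k - Q)) by ring. rewrite Hs. ring.
- replace (3 * q * (12 * f)) with (36 * (q * f)) by ring. rewrite Hf. ring.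
Qed.

(** * Numbers represented by the ternary form *)

Lemma dvdn_shift_mod (N d a b c : nat) : (d %| N)%N -> a = b %[mod N] -> b + c = 0 %[mod d] ->
  exists k, (a + c = k * d)%N.
Proof.
move=> dN ab bc; apply/dvdnP; apply/eqP.
by rewrite -modnDml -(modn_dvdm a dN) ab modn_dvdm // modnDml bc mod0n.
Qed.

Lemma hexrep_coprime3 (n : Z) : 0 < n -> n mod 3 <> 0 -> hexrep n.
Proof.
intros Hn H3. rewrite <- (Z2Nat.id n) in * by lia. revert Hn H3.
generalize (Z.to_nat n) as m. clear n. intros n Hn H3.
have n0 : (0 < n)%N by lia.
have n3 : ~~ (3 %| n)%N.
  apply/negP => /dvdnP[k nk]; apply: H3; apply/Z.mod_divide => //.
  by exists (Z.of_nat k); lia.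
have [a [aN ha chia]] := exists_residue_coprime3 n0 n3.
have N0 : (0 < 3 * n)%N by rewrite muln_gt0.
have [q [s [B [q0 qa /dvdnP[e eB]]]]] := exists_split_modulus N0 aN chia.
have d4 : (4 * n %| 4 * (3 * n))%N by rewrite dvdn_pmul2l // dvdn_mull.
rewrite -addn1 in ha.
have [k hk] := dvdn_shift_mod d4 qa ha.
apply (@hexrep_of_split _ (Z.of_nat q) (Z.of_nat s) (Z.of_nat B) (Z.of_nat k) (Z.of_nat e)).
- lia.
- lia.
- clear -hk; lia.
- clear -eB; lia.
Qed.

Lemma hexrep_triple (m : Z) : 0 < m -> m mod 3 = 1 -> hexrep (3 * m).
Proof.
intros Hm H3. rewrite <- (Z2Nat.id m) in * by lia. revert Hm H3.
generalize (Z.to_nat m) as n. clear m. intros m Hm H3.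
have m3 : (m = 1 %[mod 3])%N.
  by have := Z.div_mod (Z.of_nat m) 3; rewrite H3; lia.
have [a [aN ha a3 chia]] := exists_residue_triple m3.
have N0 : (0 < 9 * m)%N by rewrite muln_gt0; lia.
have [q [s [B [q0 qa /dvdnP[e eB]]]]] := exists_split_modulus N0 aN chia.
have d4 : (4 * m %| 4 * (9 * m))%N by rewrite dvdn_pmul2l // dvdn_mull.
have [k hk] := dvdn_shift_mod d4 qa ha.
have d3 : (3 %| 4 * (9 * m))%N by rewrite mulnA dvdn_mulr.
have a2 : (a + 2 = 0 %[mod 3])%N by rewrite -modnDml a3.
have [j hj] := dvdn_shift_mod d3 qa a2.
(* [hj] reads [q s^2 + 2 = 3 j], whereas the form [1 + 3 j] is wanted, hence [j - 1]. *)
apply (@hexrep_triple_of_split _ (Z.of_nat (m %/ 3)) (Z.of_nat q) (Z.of_nat s) (Z.of_nat B)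
  (Z.of_nat k) (Z.of_nat j - 1) (Z.of_nat e)).
- lia.
- lia.
- have := divn_eq m 3; rewrite m3; clear; lia.
- clear -hk; lia.
- clear -hj; lia.
- clear -eB; lia.
Qed.

(** * The quaternary forms *)

Lemma represents_of_hexrep (b n : Z) (y : Z) : hexrep (n - b * y^2) -> represents b n.
Proof. intros (x & z & w & H). exists x, y, z, w. lia. Qed.

Lemma represents_mul9 (b n : Z) : represents b n -> represents b (9 * n).
Proof. intros (x & y & z & w & ->). exists (3*x), (3*y), (3*z), (3*w). ring. Qed.

Lemma hexrep0 : hexrep 0.
Proof. now exists 0, 0, 0. Qed.

Lemma hexrep_mul9 (n : Z) : hexrep n -> hexrep (9 * n).
Proof. intros (x & z & w & ->). exists (3*x), (3*z), (3*w). ring. Qed.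

(** A choice of [y] in {0, 1, 2} brings [n - b y^2] to a number represented by the ternary form;
    when 3 divides [b], multiples of 9 descend to [n / 9]. *)
Lemma represents_universal (b n : Z) : 1 <= b <= 6 -> 0 <= n -> represents b n.
Proof.
intros Hb. revert n. apply (Zlt_lower_bound_ind _ 0). intros n IH Hn.
destruct (Z.eq_dec n 0) as [-> | Hn0]; [now exists 0, 0, 0, 0; ring|].
destruct (Z.eq_dec (n mod 3) 0) as [H3 | H3].
2:{ apply (@represents_of_hexrep b n 0). replace (n - b * 0^2) with n by ring.
    apply hexrep_coprime3; lia. }
assert (Em : exists m, n = 3 * m) by (exists (n / 3); Z.to_euclidean_division_equations; lia).
destruct Em as [m ->].
(* The value 3 is set apart because [y = 1] below needs [n > b]; from 6 on this holds for
   [b <= 5]. *)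
destruct (Z.eq_dec m 1) as [-> | Hm1].
{ apply (@represents_of_hexrep b _ 0). exists 0, 1, 1. ring. }
assert (Hc : b mod 3 <> 0 \/ b = 3 \/ b = 6) by (Z.to_euclidean_division_equations; lia).
destruct Hc as [Hc | Hc].
{ apply (@represents_of_hexrep b _ 1), hexrep_coprime3;
    Z.to_euclidean_division_equations; lia. }
assert (Hm : m mod 3 = 0 \/ m mod 3 = 1 \/ m mod 3 = 2)
  by (Z.to_euclidean_division_equations; lia).
destruct Hm as [Hm | [Hm | Hm]].
- assert (Ek : exists k, m = 3 * k) by (exists (m / 3); Z.to_euclidean_division_equations; lia).
  destruct Ek as [k ->]. replace (3 * (3 * k)) with (9 * k) by ring.
  apply represents_mul9, IH. lia.
- apply (@represents_of_hexrep b _ 0). replace (3 * m - b * 0^2) with (3 * m) by ring.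
  apply hexrep_triple; lia.
- destruct Hc as [-> | ->].
  { apply (@represents_of_hexrep 3 _ 1). replace (3 * m - 3 * 1^2) with (3 * (m - 1)) by ring.
    apply hexrep_triple; Z.to_euclidean_division_equations; lia. }
  assert (Ek : exists k, m = 3 * k + 2)
    by (exists (m / 3); Z.to_euclidean_division_equations; lia).
  destruct Ek as [k ->].
  destruct (Z.eq_dec k 0) as [-> | Hk0].
  { apply (@represents_of_hexrep 6 _ 1). exact hexrep0. }
  (* [y = 1] leaves [9 k], good if 3 does not divide [k]; otherwise [y = 2] leaves [9 (k - 2)] with
     [k >= 3]. *)
  destruct (Z.eq_dec (k mod 3) 0) as [Hk | Hk].
  { apply (@represents_of_hexrep 6 _ 2).
    replace (3 * (3 * k + 2) - 6 * 2^2) with (9 * (k - 2)) by ring.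
    apply hexrep_mul9, hexrep_coprime3; Z.to_euclidean_division_equations; lia. }
  apply (@represents_of_hexrep 6 _ 1).
  replace (3 * (3 * k + 2) - 6 * 1^2) with (9 * k) by ring.
  apply hexrep_mul9, hexrep_coprime3; Z.to_euclidean_division_equations; lia.
Qed.

(** Here [y = 0], and none of [6], [6 - 1], [6 - 4] has the form [z^2 + z w + w^2]; completing
    squares bounds the variables for the finite check. *)
Lemma six_not_represented (b : Z) : 6 < b -> ~ represents b 6.
Proof.
intros Hb (x & y & z & w & H).
assert (y = 0) by nia. subst y.
assert (Hxz : 4 * x^2 + 3 * z^2 + (2 * w + z)^2 = 24) by lia.
assert (Hxw : 4 * x^2 + 3 * w^2 + (2 * z + w)^2 = 24) by lia.
assert (Bx : -2 <= x <= 2) by nia.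
assert (Bz : -2 <= z <= 2) by nia.
assert (Bw : -2 <= w <= 2) by nia.
clear -H Bx Bz Bw.
assert (Cx : x = -2 \/ x = -1 \/ x = 0 \/ x = 1 \/ x = 2) by lia.
assert (Cz : z = -2 \/ z = -1 \/ z = 0 \/ z = 1 \/ z = 2) by lia.
assert (Cw : w = -2 \/ w = -1 \/ w = 0 \/ w = 1 \/ w = 2) by lia.
destruct Cx as [->|[->|[->|[->| ->]]]]; destruct Cz as [->|[->|[->|[->| ->]]]];
destruct Cw as [->|[->|[->|[->| ->]]]]; lia.
Qed.

Theorem theorem3p4 (b : Z) (hb : 0 < b) :
  (forall n : Z, 0 <= n -> represents b n) <-> (1 <= b <= 6).
Proof.
split.
- intros H. destruct (Z_lt_le_dec 6 b) as [Hb | Hb]; [|lia].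
  exfalso. apply (six_not_represented Hb). apply H. lia.
- intros Hb n. exact (represents_universal Hb).
Qed.
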